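(* Let $t>0$. For each agent $i\in\{A,B\}$ and $j\in\{1,\dots,m\}$ let $\alpha_j^i,\beta_j^i:[0,t]\to\mathbb{R}$ be continuous with $\alpha_j^i(s)\le\beta_j^i(s)$, let $\mathbf{x}_{j0}^i\in\mathbb{R}^{r_j}$, and let $\mathcal{X}_{jt}^i\subset\mathbb{R}^{r_j}$ be the reach set at time $t$ of the single-input integrator $\dot{\mathbf{x}}_j=\mathbf{A}_j\mathbf{x}_j+\mathbf{b}_ju_j$ from initial condition $\mathbf{x}_{j0}^i$ with input sets $[\alpha_j^i(s),\beta_j^i(s)]$, $0\le s\le t$. For $j\in\{1,\dots,m\}$ define $$p_j^*:=\min_{\mathbf{y}_j\in\mathbb{R}^{r_j},\ \|\mathbf{y}_j\|_2=1}\ h_{\mathcal{X}_{jt}^{A}}(\mathbf{y}_j)+h_{\mathcal{X}_{jt}^{B}}(-\mathbf{y}_j),\qquad \tilde p_j^*:=\min_{\mathbf{y}_j\in\mathbb{R}^{r_j},\ \|\mathbf{y}_j\|_2\le1}\ h_{\mathcal{X}_{jt}^{A}}(\mathbf{y}_j)+h_{\mathcal{X}_{jt}^{B}}(-\mathbf{y}_j).$$ With $\mu_j^i:=(\beta_j^i-\alpha_j^i)/2$ and $\nu_j^i:=(\beta_j^i+\alpha_j^i)/2$, set $$\mathbf{c}_j(t):=\exp(t\mathbf{A}_j)(\mathbf{x}_{j0}^{A}-\mathbf{x}_{j0}^{B})+\int_0^t(\nu_j^{A}(s)-\nu_j^{B}(s))\,\boldsymbol{\xi}_j(s)\,ds,\qquad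 \boldsymbol{\gamma}_j(s):=(\mu_j^{A}(s)+\mu_j^{B}(s))\,\boldsymbol{\xi}_j(s).$$ For $K\in\mathbb{N}$ let $\Delta s:=t/K$, $s_k:=k\Delta s$ ($k=0,\dots,K$), and let $\tilde p^*_{j,\varepsilon}$ be the optimal value of the following second order cone program, where $\varepsilon>0$ is the local truncation error due to the trapezoidal approximation of the integral $\int_0^t|\langle\boldsymbol{\gamma}_j(s),\mathbf{y}_j\rangle|ds$ with step $\Delta s$ ($\varepsilon\downarrow0$ as $\Delta s\downarrow0$): minimize, over $(\mathbf{y}_j,\boldsymbol{\theta}_j)\in\mathbb{R}^{r_j}\times\mathbb{R}^{K+1}$ with $\boldsymbol{\theta}_j=(\theta_{j,0},\dots,\theta_{j,K})$, $$\langle\mathbf{c}_j(t),\mathbf{y}_j\rangle+\langle\boldsymbol{\omega},\boldsymbol{\theta}_j\rangle,\qquad\boldsymbol{\omega}:=\Delta s\,(1/2,1,\dots,1,1/2)^\top\in\mathbb{R}^{K+1},$$ subject to $\langle\boldsymbol{\gamma}_j(s_k),\mathbf{y}_j\rangle\le\theta_{j,k}$, $-\langle\boldsymbol{\gamma}_j(s_k),\mathbf{y}_j\rangle\le\theta_{j,k}$ and $\theta_{j,k}\ge0$ for all $k=0,\dots,K$, and $\|\mathbf{y}_j\|_2\le1$. Then, for each $j\in\{1,\dots,m\}$: (i) $\tilde p_j^*=\lim_{\varepsilon\downarrow0}\tilde p^*_{j,\varepsilon}$. (ii) $\tilde p_j^*\le0$. (iii) If $\tilde p_j^*=0$ then $0\le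 p_j^*$; and $0\le p_j^*$ is equivalent to $\mathcal{X}_{jt}^{A}$ and $\mathcal{X}_{jt}^{B}$ intersecting. (iv) If $\tilde p_j^*<0$ then $\tilde p_j^*=p_j^*<0$; and $p_j^*<0$ is equivalent to $\mathcal{X}_{jt}^{A}$ and $\mathcal{X}_{jt}^{B}$ being disjoint.
   Context: Here $m\in\mathbb{N}$ and $\mathbf{r}=(r_1,\dots,r_m)^\top\in\mathbb{N}^m$ with $r_j\ge1$. $\mathbf{A}_j\in\mathbb{R}^{r_j\times r_j}$ has columns $(\mathbf{0}\,|\,\mathbf{e}_1\,|\,\mathbf{e}_2\,|\cdots|\,\mathbf{e}_{r_j-1})$ (ones on the first superdiagonal, zeros elsewhere), $\mathbf{b}_j=\mathbf{e}_{r_j}\in\mathbb{R}^{r_j}$ is the last standard basis vector, and $$\boldsymbol{\xi}_j(s):=\left(\frac{s^{r_j-1}}{(r_j-1)!},\frac{s^{r_j-2}}{(r_j-2)!},\dots,s,1\right)^\top\in\mathbb{R}^{r_j}.$$ The labels $A,B$ used as superscripts name the two agents and are unrelated to the matrices $\mathbf{A}_j$. The reach set $\mathcal{X}_{jt}$ at time $t$ from $\mathbf{x}_{j0}$ with input sets $[\alpha_j(s),\beta_j(s)]$ is the set of all $\mathbf{x}_j(t)\in\mathbb{R}^{r_j}$ where $\mathbf{x}_j(\cdot)$ solves $\dot{\mathbf{x}}_j=\mathbf{A}_j\mathbf{x}_j+\mathbf{b}_ju_j$, $\mathbf{x}_j(0)=\mathbf{x}_{j0}$, for some measurable $u_j(\cdot)$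 with $u_j(s)\in[\alpha_j(s),\beta_j(s)]$ for all $0\le s\le t$. It is compact and convex. The support function of a compact convex set $\mathcal{K}\subset\mathbb{R}^d$ is $h_{\mathcal{K}}(\mathbf{y})=\sup_{\mathbf{x}\in\mathcal{K}}\langle\mathbf{y},\mathbf{x}\rangle$, with the Euclidean inner product, here regarded as a function of $\mathbf{y}\in\mathbb{R}^d$.
   Formalization: In the definitions of c_j(t) and γ_j(s), ξ_j(s) is replaced by ξ_j(t−s): as printed, (i) fails for time-varying bounds (r=2, t=1, zero initial states, α^A=β^A=s, α^B=β^B=0). For constant bounds both forms give the same program value. *)

(* Defs.v *)
From HB Require Import structures.
From mathcomp Require Import all_boot all_order all_algebra.
From mathcomp Require Import all_classical all_reals all_analysis.

Set Implicit Arguments.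
Unset Strict Implicit.
Unset Printing Implicit Defensive.

Import Order.TTheory GRing.Theory Num.Theory.
Import numFieldNormedType.Exports.

Local Open Scope classical_set_scope.
Local Open Scope ring_scope.

Inductive agent := AgentA | AgentB.

Section Euclidean.
Context {R : realType} {n : nat}.
Implicit Types (x y : 'cV[R]_n) (K : set 'cV[R]_n).

Definition dot x y : R := \sum_(i < n) x i 0 * y i 0.

(* The library norm on matrices is the sup norm, hence a separate definition. *)
Definition norm2 x : R := Num.sqrt (dot x x).

Definition unit_sphere : set 'cV[R]_n := [set y | norm2 y = 1].

Definition unit_ball : set 'cV[R]_n := [set y | norm2 y <= 1].

(* [sup] is 0 on empty or unbounded sets; compact nonempty [K] is intended. *)
Definition support_fun K y : R := sup [set dot y x | x in K].

Definition integral_cV (D : set R) (f : R -> 'cV[R]_n) : 'cV[R]_n :=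
  \col_i \int[lebesgue_measure]_(s in D) f s i 0.

Definition expmx (A : 'M[R]_n) : 'M[R]_n :=
  limn (series (fun k => (k`!%:R)^-1 *: A ^+ k)).

End Euclidean.

Definition is_minimum {R : realType} (S : set R) (p : R) := S p /\ lbound S p.

Section ReachSet.
Context {R : realType} {n : nat}.
Implicit Types (A : 'M[R]_n) (b : 'cV[R]_n) (u : R -> R) (x : R -> 'cV[R]_n).

(* Since [u] is only measurable, x' = A x + b u is understood in the sense of
   Caratheodory, i.e. through the integral equation; taking s = 0 in it gives
   x(0) = x0. *)
Definition is_trajectory (t : R) A b (x0 : 'cV[R]_n) u x :=
  {within `[0, t], continuous x} /\
  forall s, 0 <= s <= t ->
    x s = x0 + integral_cV `[0, s] (fun tau => A *m x tau + u tau *: b).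

Definition is_admissible (t : R) (alpha beta u : R -> R) :=
  measurable_fun `[0, t] u /\
  forall s, 0 <= s <= t -> alpha s <= u s <= beta s.

Definition reach_set (t : R) A b (alpha beta : R -> R)
    (x0 : 'cV[R]_n) : set 'cV[R]_n :=
  [set z | exists u x, [/\ is_admissible t alpha beta u,
                           is_trajectory (t : R) A b x0 u x & x t = z]].

End ReachSet.

Section Integrator.
Context {R : realType}.

Definition intA n : 'M[R]_n := \matrix_(i, k) (k == i.+1 :> nat)%:R.

Definition intb n : 'cV[R]_n := \col_i (i == n.-1 :> nat)%:R.

Definition xi n (s : R) : 'cV[R]_n :=
  \col_i (s ^+ (n - i.+1) / ((n - i.+1)`!)%:R).

Definition integrator_reach_set n (t : R) (alpha beta : R -> R) (x0 : 'cV[R]_n) :=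
  reach_set t (intA n) (intb n) alpha beta x0.

End Integrator.

Section Separation.
Context {R : realType} {n : nat}.
Context (t : R) (alpha beta : agent -> R -> R) (x0 : agent -> 'cV[R]_n).

Definition halfwidth i (s : R) : R := (beta i s - alpha i s) / 2.

Definition midpoint i (s : R) : R := (beta i s + alpha i s) / 2.

(* By variation of constants the input at time s reaches the state at time t
   through exp((t - s) A) b = xi (t - s).  Writing xi s instead, as is common
   for constant input bounds, gives the same integrals only when the bounds are
   invariant under s |-> t - s. *)
Definition center : 'cV[R]_n :=
  expmx (t *: intA n) *m (x0 AgentA - x0 AgentB) +
  integral_cV `[0, t]
    (fun s => (midpoint AgentA s - midpoint AgentB s) *: xi n (t - s)).

Definition generator (s : R) : 'cV[R]_n :=
  (halfwidth AgentA s + halfwidth AgentB s) *: xi n (t - s).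

Definition separation (y : 'cV[R]_n) : R :=
  let X i := integrator_reach_set t (alpha i) (beta i) (x0 i) in
  support_fun (X AgentA) y + support_fun (X AgentB) (- y).

Definition p_sphere : R := inf [set separation y | y in unit_sphere].

Definition p_ball : R := inf [set separation y | y in unit_ball].

Definition grid_step (K : nat) : R := t / K%:R.

Definition trapezoid_weights (K : nat) : 'cV[R]_K.+1 :=
  \col_k (grid_step K * (if (k == ord0) || (k == ord_max) then 2^-1 else 1)).

Definition socp_objective (K : nat) (z : 'cV[R]_n * 'cV[R]_K.+1) : R :=
  dot center z.1 + dot (trapezoid_weights K) z.2.

Definition socp_feasible (K : nat) : set ('cV[R]_n * 'cV[R]_K.+1) :=
  [set z : 'cV[R]_n * 'cV[R]_K.+1 | (forall k : 'I_K.+1,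
              [/\ dot (generator (k%:R * grid_step K)) z.1 <= z.2 k 0,
                  - dot (generator (k%:R * grid_step K)) z.1 <= z.2 k 0
                & 0 <= z.2 k 0])
           /\ norm2 z.1 <= 1].

Definition socp_value (K : nat) : R :=
  inf [set socp_objective z | z in @socp_feasible K].

End Separation.

(* Main.v *)
(** Since the integrator matrix is nilpotent, every trajectory is given by
    variation of constants, and Fubini turns the iterated integrals of the input
    into the integral of u(s) xi(t - s).  Hence the support functions are
    attained by bang-bang inputs and the separation of the two reach sets is
    gap(y) = <c, y> + g(y) with g(y) = \int |<gamma(s), y>| ds, which is
    continuous and positively homogeneous: this yields the minima, the comparison
    of the sphere with the ball, and, by uniform continuity of gamma, the limit
    of the trapezoidal programs.

    That gap >= 0 makes the reach sets intersect is shown without their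
    closedness.  Either gap vanishes at some unit vector y0, or <c, y> / gap(y)
    attains its minimum -q <= 0 on the sphere at some y0; then g + <c, .>,
    respectively q g + (1 + q) <c, .>, is nonnegative and vanishes at y0 <> 0.
    As y0 has only finitely many switching times, g is differentiable there, and
    the vanishing gradient writes c as minus k times the integral of
    (mu_A + mu_B) sgn<xi(t - s), y0> xi(t - s), with k = 1 or k = q / (1 + q).
    So the inputs nu_A + k mu_A sgn and nu_B - k mu_B sgn steer both agents to
    the same point. *)

Require Import Defs.
From HB Require Import structures.
From mathcomp Require Import all_boot all_order all_algebra.
From mathcomp Require Import all_classical all_reals all_analysis.
From mathcomp Require Import measurable_realfun.
From mathcomp Require Import ring lra zify.

Set Implicit Arguments.
Unset Strict Implicit.
Unset Printing Implicit Defensive.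

Import Order.TTheory GRing.Theory Num.Theory.
Import numFieldNormedType.Exports.

Local Open Scope classical_set_scope.
Local Open Scope ring_scope.

(** * Bounded measurable functions and their integrals over segments *)

Section BoundedMeasurable.
Context {R : realType}.
Notation mu := (@lebesgue_measure R).
Implicit Types (A : set R) (f g : R -> R).

(** Unlike integrability, this class is stable under products; on a segment it implies
    integrability. *)
Definition bounded_measurable A f :=
  measurable_fun A f /\ exists C, forall s, A s -> `|f s| <= C.

Lemma bounded_measurable_cst A (c : R) : bounded_measurable A (fun=> c).
Proof. by split; [exact: measurable_cst|exists `|c|]. Qed.

Lemma bounded_measurableS A B f :
  measurable B -> A `<=` B -> bounded_measurable B f -> bounded_measurable A f.
Proof.
move=> mB AB [mf [C fC]]; split; first exact: measurable_funS mf.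
by exists C => s /AB; exact: fC.
Qed.

Lemma eq_bounded_measurable A f g :
  {in A, f =1 g} -> bounded_measurable A f -> bounded_measurable A g.
Proof.
move=> fg [mf [C fC]]; split; first exact: eq_measurable_fun mf.
by exists C => s As; rewrite -fg ?inE//; exact: fC.
Qed.

Lemma bounded_measurableD A f g : bounded_measurable A f ->
  bounded_measurable A g -> bounded_measurable A (fun s => f s + g s).
Proof.
move=> [mf [C fC]] [mg [D gD]]; split; first exact: measurable_funD.
exists (C + D) => s As.
by rewrite (le_trans (ler_normD _ _))// lerD ?fC ?gD.
Qed.

Lemma bounded_measurableM A f g : bounded_measurable A f ->
  bounded_measurable A g -> bounded_measurable A (fun s => f s * g s).
Proof.
move=> [mf [C fC]] [mg [D gD]]; split; first exact: measurable_funM.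
by exists (C * D) => s As; rewrite normrM ler_pM ?fC ?gD.
Qed.

Lemma bounded_measurableZ A (c : R) f :
  bounded_measurable A f -> bounded_measurable A (fun s => c * f s).
Proof. exact/bounded_measurableM/bounded_measurable_cst. Qed.

Lemma bounded_measurableB A f g : bounded_measurable A f ->
  bounded_measurable A g -> bounded_measurable A (fun s => f s - g s).
Proof.
move=> bf /(bounded_measurableZ (-1)) bg.
apply: eq_bounded_measurable (bounded_measurableD bf bg).
by move=> s _; rewrite mulN1r.
Qed.

Lemma bounded_measurable_sum A (I : Type) (s : seq I) (P : pred I)
    (F : I -> R -> R) : (forall i, bounded_measurable A (F i)) ->
  bounded_measurable A (fun x => \sum_(i <- s | P i) F i x).
Proof.
move=> bF; elim: s => [|i s IH].
  under eq_fun do rewrite big_nil; exact: bounded_measurable_cst.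
under eq_fun do rewrite big_cons.
by case: (P i) => //; exact: bounded_measurableD.
Qed.

Lemma bounded_measurable_norm A f :
  bounded_measurable A f -> bounded_measurable A (fun s => `|f s|).
Proof.
move=> [mf [C fC]]; split; first exact: measurableT_comp mf.
by exists C => s As; rewrite normr_id fC.
Qed.

Lemma measurable_sgr : measurable_fun [set: R] (@Num.sg R).
Proof.
apply: nondecreasing_measurable => // x y xy.
by case: (sgrP x); case: (sgrP y) => *; lra.
Qed.

Lemma bounded_measurable_sg A f :
  measurable_fun A f -> bounded_measurable A (fun s => Num.sg (f s)).
Proof.
move=> mf; split; first exact: measurableT_comp measurable_sgr mf.
by exists 1 => s _; case: sgrP => _; rewrite ?normr0 ?normrN1 ?normr1.
Qed.

Lemma bounded_measurable_continuous (a b : R) f :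
  {within `[a, b], continuous f} -> bounded_measurable `[a, b] f.
Proof.
move=> cf; split.
  by apply: subspace_continuous_measurable_fun => //; exact: measurable_itv.
have [C [_ HC]] := compact_bounded (continuous_compact cf (@segment_compact _ a b)).
exists (C + 1) => s sab; apply: (HC (C + 1)); first by rewrite ltrDl.
by exists s.
Qed.

Lemma bounded_measurable_cont (a b : R) f :
  continuous f -> bounded_measurable `[a, b] f.
Proof. by move=> cf; apply/bounded_measurable_continuous/continuous_subspaceT. Qed.

Lemma bounded_measurable_integrable (a b : R) f :
  bounded_measurable `[a, b] f -> mu.-integrable `[a, b] (EFin \o f).
Proof.
move=> [mf [C fC]]; apply: measurable_bounded_integrable => //.
  by rewrite /= lebesgue_measure_itv/=; case: ifP => // _; rewrite -EFinB ltry.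
exists C; split; first exact: num_real.
by move=> M CM s /fC/le_trans; apply; exact: ltW.
Qed.

Lemma Rintegral_sum (a b : R) (I : Type) (r : seq I) (P : pred I)
    (F : I -> R -> R) : (forall i, bounded_measurable `[a, b] (F i)) ->
  \int[mu]_(s in `[a, b]) (\sum_(i <- r | P i) F i s) =
  \sum_(i <- r | P i) \int[mu]_(s in `[a, b]) F i s.
Proof.
move=> bF; elim: r => [|i r IH].
  rewrite big_nil; under eq_Rintegral do rewrite big_nil.
  by rewrite Rintegral_cst// mul0r.
rewrite big_cons; under eq_Rintegral do rewrite big_cons.
case: (P i) => //; rewrite RintegralD ?IH//; apply: bounded_measurable_integrable => //.
exact: bounded_measurable_sum.
Qed.

Lemma Rintegral_itv_cst (a b c : R) : a <= b ->
  \int[mu]_(s in `[a, b]) c = c * (b - a).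
Proof.
move=> ab; rewrite Rintegral_cst//= lebesgue_measure_itv/= lte_fin.
by move: ab; rewrite le_eqVlt => /predU1P[->|->]//; rewrite ltxx subrr.
Qed.

End BoundedMeasurable.

(** * Taylor monomials and their primitives *)

Section IteratedIntegral.
Context {R : realType}.
Notation mu := (@lebesgue_measure R).
Implicit Types (u : R -> R) (k : nat) (s : R).

(** These monomials are the nonzero entries of exp(sA) and the entries of [xi n s]. *)
Definition powfact k s : R := s ^+ k / k`!%:R.

Lemma powfact0 s : powfact 0 s = 1.
Proof. by rewrite /powfact expr0 fact0 divr1. Qed.

Lemma powfactS0 k : powfact k.+1 0 = 0.
Proof. by rewrite /powfact expr0n mul0r. Qed.

Lemma powfact_ge0 k s : 0 <= s -> 0 <= powfact k s.
Proof. by move=> s0; rewrite divr_ge0// exprn_ge0. Qed.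

Lemma is_derive_powfact k (a s : R) :
  is_derive s 1 (fun x => powfact k.+1 (x - a)) (powfact k (s - a)).
Proof.
have fk : (k`!%:R : R) != 0 by rewrite pnatr_eq0 -lt0n fact_gt0.
have -> : (fun x => powfact k.+1 (x - a)) =
    ((k.+1)`!%:R : R)^-1 \*: ((id - cst a) ^+ k.+1).
  by apply/funext => x; rewrite /powfact !fctE mulrC.
apply: is_derive_eq; rewrite factS natrM /powfact /GRing.scale/=.
by rewrite -mulr_natl; field; rewrite fk nat1r pnatr_eq0.
Qed.

Lemma continuous_powfact k (a : R) : continuous (fun x => powfact k (x - a)).
Proof.
move=> s; apply: cvgMr_tmp.
apply: (@continuous_comp _ _ _ (fun x => x - a) (fun x => x ^+ k)).
  by apply: cvgB; [exact: cvg_id|exact: cvg_cst].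
exact: exprn_continuous.
Qed.

Lemma continuous_powfactN k (a : R) : continuous (fun x => powfact k (a - x)).
Proof.
move=> s; apply: cvgMr_tmp.
apply: (@continuous_comp _ _ _ (fun x => a - x) (fun x => x ^+ k)).
  by apply: cvgB; [exact: cvg_cst|exact: cvg_id].
exact: exprn_continuous.
Qed.

Lemma Rintegral_powfact k (a b : R) : a <= b ->
  \int[mu]_(s in `[a, b]) powfact k (s - a) = powfact k.+1 (b - a).
Proof.
rewrite le_eqVlt => /predU1P[->|ab].
  by rewrite set_itv1 Rintegral_set1 subrr powfactS0.
rewrite /Rintegral (@continuous_FTC2 _ _ (fun x => powfact k.+1 (x - a)))//.
- by rewrite /= subrr powfactS0 subr0.
- exact/continuous_subspaceT/continuous_powfact.
- split.
  + by move=> x _; have [] := is_derive_powfact k a x.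
  + by apply: cvg_at_right_filter; exact: continuous_powfact.
  + by apply: cvg_at_left_filter; exact: continuous_powfact.
- by move=> x _; rewrite derive1E; have [_] := is_derive_powfact k a x.
Qed.

End IteratedIntegral.

Lemma eq_within_continuous {T S : topologicalType} (A : set T) (f g : T -> S) :
  {in A, f =1 g} -> {within A, continuous f} -> {within A, continuous g}.
Proof. exact: subspace_eq_continuous. Qed.

(** * Repeated integrals of the input *)

Section Convolution.
Context {R : realType}.
Notation mu := (@lebesgue_measure R).
Implicit Types (u : R -> R) (k : nat) (s : R).

(** Cauchy's formula for repeated integration: this is the (k+1)-fold primitive of [u] that vanishes
    at 0. *)
Definition convol u k s : R :=
  \int[mu]_(a in `[0, s]) (powfact k (s - a) * u a).

Lemma bounded_measurable_sub (a b a' b' : R) u : a <= a' -> b' <= b ->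
  bounded_measurable `[a, b] u -> bounded_measurable `[a', b'] u.
Proof.
move=> aa' bb'; apply: bounded_measurableS; first exact: measurable_itv.
by move=> x /=; rewrite !in_itv/= => /andP[a'x xb']; rewrite (le_trans aa')//= (le_trans xb').
Qed.

Lemma bounded_measurable_convol (a b c : R) k u : bounded_measurable `[a, b] u ->
  bounded_measurable `[a, b] (fun x => powfact k (c - x) * u x).
Proof.
move=> bu; apply: bounded_measurableM => //.
exact/bounded_measurable_cont/continuous_powfactN.
Qed.

(** Fubini on the triangle 0 <= b <= a <= s: for fixed b, integrating [powfact k (a - b)] over a in
    [b, s] raises the kernel to [powfact k.+1 (s - b)]. *)
Lemma Rintegral_convol u k s : 0 <= s -> bounded_measurable `[0, s] u ->
  \int[mu]_(a in `[0, s]) convol u k a = convol u k.+1 s.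
Proof.
move=> s0 bu; have [mu' [C uC]] := bu.
pose D : set R := `[0, s]%classic.
have mD : measurable D by exact: measurable_itv.
have DE x : x \in D = (0 <= x <= s) by rewrite mem_setE in_itv.
(* The integrand on the triangle, extended by zero to the whole plane; [u] is cut off to [D] because
   it is known to be measurable only there. *)
pose f (z : R * R) : R := if (0 <= z.2) && ((z.2 <= z.1) && (z.1 <= s))
  then powfact k (z.1 - z.2) * (u \_ D) z.2 else 0.
have mf : measurable_fun setT f.
  apply: measurable_fun_ifT => //.
    do 2?apply: measurable_and; apply: measurable_fun_ler => //;
      solve [exact: measurable_fst|exact: measurable_snd|exact: measurable_cst].
  apply: measurable_funM.
    apply: measurable_funM => //; apply: measurable_funX; apply: measurable_funB.
      exact: measurable_fst.
    exact: measurable_snd.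
  apply: (@measurableT_comp _ _ _ _ _ _ (u \_ D) _ snd) => //.
  exact: (measurable_restrictT u mD).1.
have C0 : 0 <= C.
  by rewrite (le_trans _ (uC 0 _)) ?normr_ge0//= in_itv/= lexx.
(* A uniform bound, together with a support of finite measure, makes [f] integrable for the product
   measure. *)
have fC z : `|f z| <= powfact k s * C.
  rewrite /f; case: ifPn => [/and3P[z20 z21 z1s]|_]; last first.
    by rewrite normr0 mulr_ge0// powfact_ge0.
  rewrite normrM ler_pM//.
    rewrite ger0_norm ?powfact_ge0 ?subr_ge0//.
    rewrite ler_wpM2r ?invr_ge0// lerXn2r ?nnegrE ?subr_ge0//.
    by rewrite lerBlDr ler_wpDr.
  rewrite patchE; case: ifPn => [|_]; last by rewrite normr0.
  by rewrite inE => /uC.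
have fD : f = f \_ (D `*` D).
  apply/funext => z; rewrite patchE; case: ifPn => // zD.
  rewrite /f; case: ifPn => // /and3P[z20 z21 z1s]; case/negP: zD.
  by rewrite inE; split; rewrite -inE DE;
    rewrite ?z1s ?z20 ?(le_trans z20 z21)//= (le_trans z21).
have muD : (mu D < +oo)%E.
  by rewrite /D /= lebesgue_measure_itv/=; case: ifP => // _; rewrite -EFinB ltry.
have intf : (mu \x mu)%E.-integrable setT (EFin \o f).
  have -> : EFin \o f = (EFin \o f) \_ (D `*` D).
    by rewrite restrict_EFin -fD.
  have mDD : measurable (D `*` D) by exact: measurableX.
  have := integrable_mkcond (mu := (mu \x mu)%E) (EFin \o f) mDD.
  move=> [+ _]; apply.
  apply: measurable_bounded_integrable => //.
  - rewrite [X in (X < _)%E](_ : _ = mu D * mu D)%E; last first.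
      exact: product_measure1E.
    by apply: lte_mul_pinfty => //; rewrite ge0_fin_numE.
  - exact: measurable_funTS.
  - exists (powfact k s * C); split; first exact: num_real.
    by move=> M CM z _; exact: le_trans (fC z) (ltW CM).
have inner1 x : (\int[mu]_y (f (x, y))%:E = ((convol u k \_ D) x)%:E)%E.
  rewrite patchE; case: ifPn => xD; last first.
    rewrite (eq_integral (cst 0%E)) ?integral0// => y _; congr EFin.
    rewrite /f /=; case: ifPn => // /and3P[y0 yx xs].
    by rewrite DE xs (le_trans y0 yx) in xD.
  move: (xD); rewrite DE => /andP[x0 xs].
  rewrite /convol /Rintegral fineK; last first.
    apply: integrable_fin_num => //; apply: bounded_measurable_integrable.
    by apply: bounded_measurable_convol; exact: bounded_measurable_sub bu.
  rewrite [RHS]integral_mkcond; apply: eq_integral => y _.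
  rewrite restrict_EFin /=; congr EFin.
  rewrite patchE mem_setE in_itv /f /= xs andbT; case: ifP => // /andP[y0 yx].
  by rewrite patchE DE y0 (le_trans yx xs).
have inner2 y : (\int[mu]_x (f (x, y))%:E =
    (((fun a => powfact k.+1 (s - a) * u a) \_ D) y)%:E)%E.
  rewrite patchE; case: ifPn => yD; last first.
    rewrite (eq_integral (cst 0%E)) ?integral0// => x _; congr EFin.
    rewrite /f /=; case: ifPn => // /and3P[y0 yx xs].
    by rewrite DE y0 (le_trans yx xs) in yD.
  move: (yD); rewrite DE => /andP[y0 ys].
  have bp : bounded_measurable `[y, s] (fun x => powfact k (x - y)).
    exact/bounded_measurable_cont/continuous_powfact.
  rewrite -(Rintegral_powfact _ ys) -RintegralZr//; last first.
    exact: bounded_measurable_integrable.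
  rewrite /Rintegral fineK; last first.
    apply: integrable_fin_num => //; apply: bounded_measurable_integrable.
    exact/bounded_measurableM/bounded_measurable_cst.
  rewrite [RHS]integral_mkcond; apply: eq_integral => x _.
  rewrite restrict_EFin /=; congr EFin.
  rewrite patchE mem_setE in_itv /f /= y0/=; case: ifP => // /andP[yx xs].
  by rewrite patchE yD.
have := Fubini intf.
under eq_integral do rewrite /= inner1.
under [RHS]eq_integral do rewrite /= inner2.
by move=> E; rewrite [RHS]/convol [LHS]Rintegral_mkcond [RHS]Rintegral_mkcond /Rintegral E.
Qed.

(** Each [convol u k.+1] is the primitive of [convol u k], so the claim follows by induction from
    the continuity of indefinite integrals. *)
Lemma continuous_convol (t : R) u k : 0 <= t -> bounded_measurable `[0, t] u ->
  {within `[0, t], continuous (convol u k)}.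
Proof.
move=> t0 bu; elim: k => [|k IH].
  have E : {in `[0, t]%classic, (fun x => \int[mu]_(a in `[0, x]) u a) =1 convol u 0}.
    by move=> x _ /=; rewrite /convol; under [RHS]eq_Rintegral do rewrite powfact0 mul1r.
  apply: (eq_within_continuous E); apply: parameterized_integral_continuous => //.
  exact: bounded_measurable_integrable.
have E : {in `[0, t]%classic,
    (fun x => \int[mu]_(a in `[0, x]) convol u k a) =1 convol u k.+1}.
  move=> x /=; rewrite inE/= in_itv/= => /andP[x0 xt].
  by rewrite Rintegral_convol//; exact: bounded_measurable_sub bu.
apply: (eq_within_continuous E); apply: parameterized_integral_continuous => //.
exact/bounded_measurable_integrable/bounded_measurable_continuous.
Qed.

End Convolution.

(** * Variation of constants for the integrator chain *)

Section IntegratorFlow.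
Context {R : realType} {n : nat}.
Notation mu := (@lebesgue_measure R).
Implicit Types (u : R -> R) (s t : R).

(** Closed form of exp(sA), justified by [expmx_intA]. *)
Definition expA s : 'M[R]_n :=
  \matrix_(i, l) if (i <= l)%N then powfact (l - i) s else 0.

(** Variation of constants: since exp(sA) b is [xi n s], each entry of its convolution with [u] is a
    repeated integral of [u]. *)
Definition flow (x0 : 'cV[R]_n) u s : 'cV[R]_n :=
  expA s *m x0 + \col_i convol u (n - i.+1) s.

Lemma exp_intA t k (i l : 'I_n) :
  ((t *: intA n) ^+ k) i l = t ^+ k * (l == (i + k)%N :> nat)%:R.
Proof.
elim: k i l => [|k IH] i l; first by rewrite !expr0 mxE addn0 mul1r eq_sym.
rewrite exprSr mxE exprSr.
have [lt_ik|le_n] := ltnP (i + k)%N n.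
  rewrite (bigD1 (Ordinal lt_ik))//= IH/= eqxx mulr1 !mxE /= addnS mulrA big1 ?addr0//.
  by move=> j; rewrite -val_eqE/= IH => /negPf ->; rewrite mulr0 mul0r.
rewrite big1 ?addnS => [|j _].
  by rewrite (ltn_eqF (leq_trans (ltn_ord l) _)) ?mulr0// leqW.
by rewrite IH (ltn_eqF (leq_trans (ltn_ord j) _))// mulr0 mul0r.
Qed.

(** By nilpotency the partial sums of the exponential series are constant from the n-th on, and an
    entry (i, l) with i <= l keeps only the term k = l - i. *)
Lemma expmx_intA t : expmx (t *: intA n) = expA t.
Proof.
apply: (@cvg_lim _ (@norm_hausdorff _ _)).
apply: cvg_near_cst; exists n => // N /= nN.
apply/matrixP => i l; rewrite /series/= summxE mxE.
under eq_bigr do rewrite mxE exp_intA.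
case: leqP => [il|li].
  rewrite big_mkord.
  have liN : (l - i < N)%N.
    by rewrite (leq_trans _ nN)// (leq_ltn_trans (leq_subr _ _)).
  rewrite (bigD1 (Ordinal liN))//= subnKC// eqxx mulr1 mulrC big1 ?addr0//.
  move=> k kli; case: eqP => [lik|]; last by rewrite !mulr0.
  by case/eqP: kli; apply/val_inj; rewrite /= lik addKn.
rewrite big1// => k _; case: eqP => [lik|]; last by rewrite !mulr0.
by move: li; rewrite lik ltnNge leq_addr.
Qed.

Lemma integrator_rhs_next (i l : 'I_n) (x : 'cV[R]_n) (a : R) : l = i.+1 :> nat ->
  (intA n *m x + a *: intb n) i 0 = x l 0.
Proof.
move=> li; rewrite !mxE (bigD1 l)//= mxE li eqxx mul1r big1 ?addr0.
  rewrite (_ : (i == n.-1 :> nat) = false) ?mulr0 ?addr0//.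
  by have := ltn_ord l; rewrite li; case: n i {x l li} => [[]//|n' i /=] /ltn_eqF.
by move=> j jl; rewrite mxE -li val_eqE (negPf jl) mul0r.
Qed.

Lemma integrator_rhs_last (i : 'I_n) (x : 'cV[R]_n) (a : R) : i.+1 = n ->
  (intA n *m x + a *: intb n) i 0 = a.
Proof.
move=> iE; rewrite !mxE big1 ?add0r; last first.
  by move=> j _; rewrite mxE iE (ltn_eqF (ltn_ord j)) mul0r.
by rewrite -[X in X.-1]iE eqxx mulr1.
Qed.

(** Together with [expA_last], this gives the rows of exp(sA) = I + \int_0^s A exp(aA) da. *)
Lemma expA_next (i l k : 'I_n) s : 0 <= s -> l = i.+1 :> nat ->
  expA s i k = (i == k)%:R + \int[mu]_(a in `[0, s]) expA a l k.
Proof.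
move=> s0 li; rewrite mxE -val_eqE/=; under eq_Rintegral do rewrite mxE li.
case: (ltngtP i k) => ik.
- rewrite add0r -[s in LHS]subr0 -(prednK (_ : 0 < k - i)%N) ?subn_gt0//.
  rewrite -Rintegral_powfact// -subnS.
  by apply: eq_Rintegral => x _; rewrite subr0.
- by rewrite Rintegral_cst// mul0r addr0.
- by rewrite Rintegral_cst// mul0r addr0 ik subnn powfact0.
Qed.

Lemma expA_last (i k : 'I_n) s : i.+1 = n -> expA s i k = (i == k)%:R.
Proof.
move=> iE; rewrite mxE -val_eqE/=; case: (ltngtP i k) => // [ik|->].
  by have := leq_ltn_trans ik (ltn_ord k); rewrite [X in (_ < X)%N -> _](esym iE) ltnn.
by rewrite subnn powfact0.
Qed.

Lemma continuous_expA i k : continuous (fun s => expA s i k).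
Proof.
have -> : (fun s => expA s i k) =
    fun s => if (i <= k)%N then powfact (k - i) (s - 0) else 0.
  by apply/funext => s; rewrite mxE subr0.
by case: (i <= k)%N; [exact: continuous_powfact|move=> ?; exact: cvg_cst].
Qed.

Lemma continuous_flow t x0 u i : 0 <= t -> bounded_measurable `[0, t] u ->
  {within `[0, t], continuous (fun s => flow x0 u s i 0)}.
Proof.
move=> t0 bu; have -> : (fun s => flow x0 u s i 0) =
    fun s => \sum_k expA s i k * x0 k 0 + convol u (n - i.+1) s.
  by apply/funext => s; rewrite !mxE.
apply: within_continuousD; last exact: continuous_convol.
apply/continuous_subspaceT/continuous_big => [|k _ s].
  exact: add_continuous.
by apply: cvgMr_tmp; exact: continuous_expA.
Qed.

(** Checked row by row. In the last row the exponential is constant and the convolution is the plain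
    primitive of [u]; in any other row, up to the initial value, both terms are primitives of their
    counterparts one row below. *)
Lemma flowE t x0 u s : 0 <= s <= t -> bounded_measurable `[0, t] u ->
  flow x0 u s = x0 +
    integral_cV `[0, s] (fun a => intA n *m flow x0 u a + u a *: intb n).
Proof.
move=> /andP[s0 st] /(bounded_measurable_sub (lexx 0) st) bu.
apply/colP => i; rewrite [LHS]mxE [RHS]mxE [X in _ + X = _]mxE [X in X + _ = _]mxE.
rewrite [X in _ = _ + X]mxE.
have mulx0 (F : 'I_n -> R) : \sum_k ((i == k)%:R + F k) * x0 k 0 =
    x0 i 0 + \sum_k F k * x0 k 0.
  under eq_bigr do rewrite mulrDl.
  rewrite big_split/=; congr (_ + _).
  rewrite (bigD1 i)//= eqxx mul1r big1 ?addr0// => k; rewrite eq_sym => /negPf ->.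
  by rewrite mul0r.
have [iE|iE] := eqVneq i.+1 n.
  under eq_bigr do rewrite (expA_last _ _ iE) -[_%:R]addr0.
  rewrite mulx0 big1 ?addr0; last by move=> *; rewrite mul0r.
  congr (_ + _); rewrite iE subnn.
  apply: eq_Rintegral => a _.
  by rewrite powfact0 mul1r integrator_rhs_last.
have ltin : (i.+1 < n)%N by rewrite ltn_neqAle iE ltn_ord.
pose l := Ordinal ltin.
under eq_bigr do rewrite (@expA_next i l)//.
rewrite mulx0 -addrA; congr (_ + _).
under [RHS]eq_Rintegral do rewrite (@integrator_rhs_next i l)// !mxE.
have bE k : bounded_measurable `[0, s] (fun a => expA a l k * x0 k 0).
  apply: bounded_measurableM (bounded_measurable_cst _ _).
  exact/bounded_measurable_cont/continuous_expA.
rewrite RintegralD//; last 2 first.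
- exact/bounded_measurable_integrable/bounded_measurable_sum.
- exact/bounded_measurable_integrable/bounded_measurable_continuous/continuous_convol.
rewrite Rintegral_sum// Rintegral_convol//= -subSn// subSS; congr (_ + _).
apply: eq_bigr => k _; rewrite RintegralZr//.
exact/bounded_measurable_integrable/bounded_measurable_cont/continuous_expA.
Qed.

Lemma continuous_mx (T : topologicalType) m p (f : T -> 'M[R]_(m, p)) :
  (forall i k, continuous (fun x => f x i k)) -> continuous f.
Proof.
move=> cf x; apply/cvgrPdist_lt => e e0.
have : \forall y \near x, forall ik : 'I_m * 'I_p,
    `|f x ik.1 ik.2 - f y ik.1 ik.2| < e.
  apply: filter_forall => -[i k] /=.
  exact: (cvgrPdist_lt _ _).1 (cf i k x) e e0.
apply: filterS => y fe; rewrite /Num.norm/= mx_normrE.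
apply/bigmax_ltP; split => // -[i k] _ /=.
by have := fe (i, k); rewrite !mxE.
Qed.

Lemma flow_trajectory t x0 u : 0 <= t -> bounded_measurable `[0, t] u ->
  is_trajectory t (intA n) (intb n) x0 u (flow x0 u).
Proof.
move=> t0 bu; split; last by move=> s st; exact: flowE bu.
apply: continuous_mx => i k; rewrite ord1.
exact: continuous_flow.
Qed.

(** Induction from the last coordinate upwards: the integral equation of a coordinate involves only
    the input or the next coordinate, which is already known to agree. *)
Lemma trajectory_unique t x0 u (x : R -> 'cV[R]_n) : bounded_measurable `[0, t] u ->
  is_trajectory t (intA n) (intb n) x0 u x -> forall s, 0 <= s <= t ->
  x s = flow x0 u s.
Proof.
move=> bu [_ xE].
suff H k (i : 'I_n) : (n - i.+1)%N = k -> forall s, 0 <= s <= t ->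
    x s i 0 = flow x0 u s i 0.
  by move=> s st; apply/colP => i; exact: H st.
elim: k i => [|k IH] i ik s st; rewrite xE// (flowE _ st bu) !mxE; congr (_ + _);
    apply: eq_Rintegral => a; rewrite inE/= in_itv/= => /andP[a0 as_].
  have iE : i.+1 = n by apply/eqP; rewrite eqn_leq ltn_ord/= -subn_eq0 ik.
  by rewrite !integrator_rhs_last.
have ltin : (i.+1 < n)%N by rewrite -subn_gt0 ik.
rewrite !(@integrator_rhs_next i (Ordinal ltin))//; apply: IH => /=.
  by rewrite subnS ik.
by apply/andP; split=> //; rewrite (le_trans as_)//; case/andP: st.
Qed.

(** Admissible inputs are bounded because they lie between [alpha] and [beta], so existence and
    uniqueness of trajectories apply to them. *)
Lemma reach_setE t (alpha beta : R -> R) x0 : 0 <= t ->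
  bounded_measurable `[0, t] alpha -> bounded_measurable `[0, t] beta ->
  integrator_reach_set t alpha beta x0 =
  [set flow x0 u t | u in is_admissible t alpha beta].
Proof.
move=> t0 [_ [C aC]] [_ [D bD]].
have adm u : is_admissible t alpha beta u -> bounded_measurable `[0, t] u.
  move=> [mu' uab]; split=> //; exists (C + D) => s st.
  have := aC _ st; have := bD _ st; move: st => /=; rewrite in_itv/= => /uab.
  by rewrite !ler_norml => /andP[? ?] /andP[? ?] /andP[? ?]; apply/andP; split; lra.
apply/seteqP; split=> z.
  move=> [u [x [uad xtr <-]]]; exists u => //.
  by rewrite (trajectory_unique (adm _ uad) xtr)// t0 lexx.
move=> [u uad <-]; exists u, (flow x0 u); split=> //.
exact/flow_trajectory/adm.
Qed.

End IntegratorFlow.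

(** * Euclidean norm, compactness of ball and sphere, minima of positively homogeneous functions *)

Lemma continuous_modulus {R : realType} {T : topologicalType} (h : T -> T -> R)
    (f : T -> R) : (forall x, continuous (h x)) -> (forall x, h x x = 0) ->
  (forall x y, `|f x - f y| <= h x y) -> continuous f.
Proof.
move=> ch hxx fh x; apply/cvgrPdist_le => e e0.
have /cvgrPdist_le/(_ e e0) := ch x x.
apply: filterS => y; rewrite hxx sub0r normrN; apply: le_trans.
by rewrite (le_trans (fh x y))// ler_norm.
Qed.

Section EuclideanFacts.
Context {R : realType} {n : nat}.
Implicit Types (x y z : 'cV[R]_n) (a : R) (f : 'cV[R]_n -> R).

Lemma dotC x y : dot x y = dot y x.
Proof. by apply: eq_bigr => i _; rewrite mulrC. Qed.

Lemma dotDr x y z : dot x (y + z) = dot x y + dot x z.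
Proof. by rewrite -big_split; apply: eq_bigr => i _; rewrite mxE mulrDr. Qed.

Lemma dotZr a x y : dot x (a *: y) = a * dot x y.
Proof. by rewrite mulr_sumr; apply: eq_bigr => i _; rewrite mxE mulrCA. Qed.

Lemma dotNr x y : dot x (- y) = - dot x y.
Proof. by rewrite -scaleN1r dotZr mulN1r. Qed.

Lemma dot0r x : dot x 0 = 0.
Proof. by rewrite -(scale0r 0) dotZr mul0r. Qed.

Lemma dotDl x y z : dot (x + y) z = dot x z + dot y z.
Proof. by rewrite !(dotC _ z) dotDr. Qed.

Lemma dotZl a x y : dot (a *: x) y = a * dot x y.
Proof. by rewrite !(dotC _ y) dotZr. Qed.

Lemma dot_delta x i : dot x (delta_mx i 0) = x i 0.
Proof.
rewrite /dot (bigD1 i)//= mxE !eqxx mulr1 big1 ?addr0// => k ki.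
by rewrite mxE (negPf ki) mulr0.
Qed.

Lemma norm2_ge0 x : 0 <= norm2 x.
Proof. exact: sqrtr_ge0. Qed.

Lemma dotxx_ge0 x : 0 <= dot x x.
Proof. by apply: sumr_ge0 => i _; rewrite -expr2 sqr_ge0. Qed.

Lemma norm2Z a x : norm2 (a *: x) = `|a| * norm2 x.
Proof.
by rewrite /norm2 dotZr dotZl mulrA -expr2 sqrtrM ?sqr_ge0// sqrtr_sqr.
Qed.

Lemma norm2N x : norm2 (- x) = norm2 x.
Proof. by rewrite -scaleN1r norm2Z normrN1 mul1r. Qed.

Lemma norm2_0 : norm2 (0 : 'cV[R]_n) = 0.
Proof. by rewrite /norm2 dot0r sqrtr0. Qed.

Lemma le_norm2 x i : `|x i 0| <= norm2 x.
Proof.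
rewrite -sqrtr_sqr ler_sqrt ?dotxx_ge0// /dot (bigD1 i)//= -expr2 lerDl.
by apply: sumr_ge0 => k _; rewrite -expr2 sqr_ge0.
Qed.

Lemma norm2_eq0 x : norm2 x = 0 -> x = 0.
Proof.
move=> x0; apply/colP => i; apply/eqP; rewrite mxE -normr_eq0.
by have := le_norm2 x i; rewrite x0 normr_le0 normr_eq0.
Qed.

Lemma unit_sphere_normalize x : x != 0 -> unit_sphere ((norm2 x)^-1 *: x).
Proof.
move=> x0; have nx0 : norm2 x != 0 by apply: contra_neq x0; exact: norm2_eq0.
by rewrite /unit_sphere/= norm2Z ger0_norm ?invr_ge0 ?norm2_ge0// mulVf.
Qed.

Lemma continuous_lipschitz (c : 'I_n -> R) f :
  (forall x y, `|f x - f y| <= \sum_i c i * `|x i 0 - y i 0|) -> continuous f.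
Proof.
apply: continuous_modulus => x.
  apply: continuous_big => [|i _ y]; first exact: add_continuous.
  have cvgx : (fun z : 'cV[R]_n => x i 0 - z i 0) @ y --> x i 0 - y i 0.
    exact: cvgB (cvg_cst _) (@coord_continuous R n 1 i 0 y).
  exact: cvgMl_tmp (cvg_norm cvgx).
by apply: big1 => i _; rewrite subrr normr0 mulr0.
Qed.

Lemma continuous_dot x : continuous (dot x).
Proof.
apply: continuous_big => [|i _ y]; first exact: add_continuous.
exact: cvgMl_tmp (@coord_continuous R n 1 i 0 y).
Qed.

Lemma continuous_norm2 : continuous (@norm2 R n).
Proof.
move=> x; apply: (@continuous_comp _ _ _ (fun y : 'cV[R]_n => dot y y) Num.sqrt).
  apply: (@continuous_big _ _ _ _ predT add_continuous) => i _ y.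
  exact: cvgM (@coord_continuous R n 1 i 0 y) (@coord_continuous R n 1 i 0 y).
exact: sqrt_continuous.
Qed.

(** The ball is closed and lies in the cube [-1, 1]^n, whose compactness is carried from row vectors
    to columns by transposition. *)
Lemma compact_unit_ball : compact (unit_ball : set 'cV[R]_n).
Proof.
pose box : set 'rV[R]_n := [set v : 'rV[R]_n | forall i, v ord0 i \in `[-1, 1]].
have cb : compact box.
  apply: (@rV_compact _ _ (fun=> `[-1 : R, 1]%classic)) => i.
  exact: segment_compact.
have cbox : compact (trmx @` box : set 'cV[R]_n).
  apply: continuous_compact cb.
  apply/continuous_subspaceT/continuous_mx => i k.
  under eq_fun do rewrite mxE.
  exact: coord_continuous.
apply: (subclosed_compact _ cbox).
  rewrite (_ : unit_ball = @norm2 R n @^-1` [set x | x <= 1])//.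
  by apply: closed_comp => [x _|]; [exact: continuous_norm2|exact: closed_le].
move=> y y1; exists y^T; last exact: trmxK.
move=> i; rewrite mxE in_itv/= -ler_norml.
exact: le_trans (le_norm2 _ _) y1.
Qed.

Lemma compact_unit_sphere : compact (unit_sphere : set 'cV[R]_n).
Proof.
apply: (subclosed_compact _ compact_unit_ball).
  rewrite (_ : unit_sphere = @norm2 R n @^-1` [set x | x = 1])//.
  by apply: closed_comp => [x _|]; [exact: continuous_norm2|exact: closed_eq].
by move=> y y1; rewrite /unit_ball/= y1.
Qed.

Lemma unit_ball_neq0 : (unit_ball : set 'cV[R]_n) !=set0.
Proof. by exists 0; rewrite /unit_ball/= norm2_0. Qed.

Lemma unit_sphere_neq0 : (0 < n)%N -> (unit_sphere : set 'cV[R]_n) !=set0.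
Proof.
move=> n0; exists (delta_mx (Ordinal n0) 0).
by rewrite /unit_sphere/= /norm2 dot_delta mxE !eqxx sqrtr1.
Qed.

Lemma compact_min f (K : set 'cV[R]_n) : continuous f -> compact K -> K !=set0 ->
  exists2 y, K y & forall z, K z -> f y <= f z.
Proof.
move=> cf cK K0.
have [y] := compact_EVT_min K0 cK (continuous_subspaceT cf).
by rewrite inE => Ky fy; exists y => // z Kz; apply: fy; rewrite inE.
Qed.

Lemma is_minimum_inf (S : set R) (p : R) : is_minimum S p -> inf S = p.
Proof.
move=> [Sp pS]; apply/le_anti/andP; split.
  by apply: ge_inf => //; exists p.
by apply: lb_le_inf => //; exists p.
Qed.

(** Ensures that the infima defining [p_sphere] and [p_ball] are genuine minima and not default
    values of [inf]. *)
Lemma inf_compact f (K : set 'cV[R]_n) : continuous f -> compact K -> K !=set0 ->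
  is_minimum [set f y | y in K] (inf [set f y | y in K]).
Proof.
move=> cf cK K0; have [y Ky fy] := compact_min cf cK K0.
suff H : is_minimum [set f y | y in K] (f y) by rewrite (is_minimum_inf H).
by split; [exists y|move=> _ [z Kz <-]; exact: fy].
Qed.

Definition pos_homogeneous f := forall a y, 0 <= a -> f (a *: y) = a * f y.

Lemma pos_homogeneous0 f : pos_homogeneous f -> f 0 = 0.
Proof. by move=> fZ; rewrite -(scale0r 0) fZ// mul0r. Qed.

Lemma pos_homogeneous_ge0 f : pos_homogeneous f ->
  (forall y, unit_sphere y -> 0 <= f y) -> forall y, 0 <= f y.
Proof.
move=> fZ f0 y; have [->|y0] := eqVneq y 0; first by rewrite pos_homogeneous0.
have := f0 _ (unit_sphere_normalize y0).
rewrite fZ ?invr_ge0 ?norm2_ge0// pmulr_rge0// invr_gt0 lt_def norm2_ge0 andbT.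
by apply: contra_neq y0; exact: norm2_eq0.
Qed.

(** A negative minimum over the ball is attained at some y <> 0. Scaling y out to the sphere
    multiplies the negative value by 1 / |y| >= 1, which cannot increase it, so p <= q; the other
    inequality is the inclusion of the sphere in the ball. *)
Lemma pos_homogeneous_min_neg f p q : pos_homogeneous f ->
  is_minimum [set f y | y in unit_sphere] p ->
  is_minimum [set f y | y in unit_ball] q -> q < 0 -> q = p.
Proof.
move=> fZ [[z z1 fz] pl] [[y y1 fy] ql] q0; apply/le_anti/andP; split.
  by apply: ql; exists z => //; rewrite /unit_ball/= z1.
have y0 : y != 0.
  by apply/eqP => y0; move: q0; rewrite -fy y0 pos_homogeneous0// ltxx.
have ny0 : 0 < norm2 y.
  by rewrite lt_def norm2_ge0 andbT; apply: contra_neq y0; exact: norm2_eq0.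
have /le_trans := pl _ (ex_intro2 _ _ _ (unit_sphere_normalize y0) erefl); apply.
rewrite fZ ?invr_ge0 ?norm2_ge0// fy -subr_ge0 -[X in X - _]mul1r -mulrBl.
rewrite nmulr_lge0// subr_le0 invf_ge1//.
Qed.

End EuclideanFacts.

(** * Support functions of the reach sets *)

Section Support.
Context {R : realType} {n : nat}.
Notation mu := (@lebesgue_measure R).
Context (t : R).
Implicit Types (y : 'cV[R]_n) (s : R).

(** The weight that the input at time s carries in <x(t), y>. *)
Definition response y s : R := dot (xi n (t - s)) y.

Lemma responseD y z s : response (y + z) s = response y s + response z s.
Proof. exact: dotDr. Qed.

Lemma responseZ a y s : response (a *: y) s = a * response y s.
Proof. exact: dotZr. Qed.

Lemma responseN y s : response (- y) s = - response y s.
Proof. exact: dotNr. Qed.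

Lemma continuous_xi i : continuous (fun s => xi n (t - s) i 0 : R).
Proof.
have -> : (fun s => xi n (t - s) i 0 : R) = fun s => powfact (n - i.+1) (t - s).
  by apply/funext => s; rewrite mxE.
exact: continuous_powfactN.
Qed.

Lemma continuous_response y : continuous (response y).
Proof.
apply: continuous_big => [|i _ s]; first exact: add_continuous.
by apply: cvgMr_tmp; exact: continuous_xi.
Qed.

Lemma bounded_measurable_response (a b : R) y :
  bounded_measurable `[a, b] (response y).
Proof. exact/bounded_measurable_cont/continuous_response. Qed.

Lemma bounded_measurable_scale_xi (w : R -> R) i : bounded_measurable `[0, t] w ->
  bounded_measurable `[0, t] (fun s => (w s *: xi n (t - s)) i 0).
Proof.
move=> bw; apply: (eq_bounded_measurable (f := fun s => w s * xi n (t - s) i 0)).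
  by move=> s _; rewrite !mxE.
exact/(bounded_measurableM bw)/bounded_measurable_cont/continuous_xi.
Qed.

Lemma dot_integral_xi (w : R -> R) y : bounded_measurable `[0, t] w ->
  dot (integral_cV `[0, t] (fun s => w s *: xi n (t - s))) y =
  \int[mu]_(s in `[0, t]) (w s * response y s).
Proof.
move=> bw; under [RHS]eq_Rintegral do rewrite mulr_sumr.
have bx i := bounded_measurable_scale_xi i bw.
rewrite Rintegral_sum => [|i]; last first.
  apply: (eq_bounded_measurable (f := fun s => (w s *: xi n (t - s)) i 0 * y i 0)).
    by move=> s _; rewrite mxE mulrA.
  exact: bounded_measurableM (bx i) (bounded_measurable_cst _ _).
apply: eq_bigr => i _; rewrite mxE -RintegralZr//; last first.
  exact: bounded_measurable_integrable.
by apply: eq_Rintegral => s _; rewrite mxE mulrA.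
Qed.

Lemma flow_xi x0 (u : R -> R) :
  flow x0 u t = expA t *m x0 + integral_cV `[0, t] (fun s => u s *: xi n (t - s)).
Proof.
congr (_ + _); apply/colP => i; rewrite !mxE; apply: eq_Rintegral => s _.
by rewrite !mxE mulrC.
Qed.

Lemma integral_xiD (f g : R -> R) :
  bounded_measurable `[0, t] f -> bounded_measurable `[0, t] g ->
  integral_cV `[0, t] (fun s => (f s + g s) *: xi n (t - s)) =
  integral_cV `[0, t] (fun s => f s *: xi n (t - s)) +
  integral_cV `[0, t] (fun s => g s *: xi n (t - s)).
Proof.
move=> bf bg; apply/colP => i; rewrite !mxE -RintegralD//; last 2 first.
- exact/bounded_measurable_integrable/bounded_measurable_scale_xi.
- exact/bounded_measurable_integrable/bounded_measurable_scale_xi.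
by apply: eq_Rintegral => s _; rewrite !mxE mulrDl.
Qed.

Lemma integral_xiZ (a : R) (f : R -> R) : bounded_measurable `[0, t] f ->
  integral_cV `[0, t] (fun s => (a * f s) *: xi n (t - s)) =
  a *: integral_cV `[0, t] (fun s => f s *: xi n (t - s)).
Proof.
move=> bf; apply/colP => i; rewrite !mxE -RintegralZl//; last first.
  exact/bounded_measurable_integrable/bounded_measurable_scale_xi.
by apply: eq_Rintegral => s _; rewrite [LHS]mxE [X in _ = _ * X]mxE mulrA.
Qed.

Lemma sup_max (S : set R) (p : R) : S p -> ubound S p -> sup S = p.
Proof.
move=> Sp Sub; apply/le_anti/andP; split.
  by apply: ge_sup => //; exists p.
by apply: ub_le_sup => //; exists p.
Qed.

Lemma sgrM_norm (x : R) : Num.sg x * x = `|x|.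
Proof. by rewrite normrEsg. Qed.

(** The integrand is the maximum of u times [response y s] over u in [alpha s, beta s], written with
    midpoint and half-width. *)
Definition support_value (alpha beta : R -> R) (x0 y : 'cV[R]_n) : R :=
  dot (expA t *m x0) y +
  \int[mu]_(s in `[0, t]) ((beta s + alpha s) / 2 * response y s +
                           (beta s - alpha s) / 2 * `|response y s|).

(* The maximum is attained by the bang-bang input switching on the sign of the
   response. *)
Lemma support_valueP (alpha beta : R -> R) x0 y : 0 <= t ->
  bounded_measurable `[0, t] alpha -> bounded_measurable `[0, t] beta ->
  (forall s, 0 <= s <= t -> alpha s <= beta s) ->
  let S := [set dot y x | x in integrator_reach_set t alpha beta x0] in
  S (support_value alpha beta x0 y) /\ ubound S (support_value alpha beta x0 y).
Proof.
move=> t0 ba bb leab.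
have bhalf f : bounded_measurable `[0, t] f ->
    bounded_measurable `[0, t] (fun s => f s / 2).
  by move=> bf; apply: bounded_measurableM => //; exact: bounded_measurable_cst.
have bnu := bhalf _ (bounded_measurableD bb ba).
have bmu := bhalf _ (bounded_measurableB bb ba).
have br := bounded_measurable_response 0 t y.
have bsg : bounded_measurable `[0, t] (fun s => Num.sg (response y s)).
  by apply: bounded_measurable_sg; case: br.
split.
  pose u s := (beta s + alpha s) / 2 + (beta s - alpha s) / 2 * Num.sg (response y s).
  have bu : bounded_measurable `[0, t] u.
    exact/bounded_measurableD/bounded_measurableM.
  exists (flow x0 u t).
    rewrite reach_setE//; exists u => //; split; first by case: bu.
    move=> s /leab ab; rewrite /u; apply/andP.
    by case: (sgrP (response y s)) => _; split; lra.
  rewrite dotC flow_xi dotDl dot_integral_xi//; congr (_ + _).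
  by apply: eq_Rintegral => s _; rewrite /u mulrDl -[X in _ + X]mulrA sgrM_norm.
move=> _ [x + <-]; rewrite reach_setE// => -[u [mu' uab] <-].
have bu : bounded_measurable `[0, t] u.
  split=> //; have [[_ [C aC]] [_ [D bD]]] := (ba, bb); exists (C + D) => s st.
  have := aC _ st; have := bD _ st; move: st => /=; rewrite in_itv/= => /uab.
  by rewrite !ler_norml => /andP[? ?] /andP[? ?] /andP[? ?]; apply/andP; split; lra.
rewrite dotC flow_xi dotDl dot_integral_xi// lerD2l; apply: le_Rintegral => //.
- exact/bounded_measurable_integrable/bounded_measurableM.
- apply/bounded_measurable_integrable/bounded_measurableD; apply: bounded_measurableM => //.
  exact: bounded_measurable_norm.
- move=> s /=; rewrite in_itv/= => /uab /andP[au ub].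
  (* The input differs from the midpoint by at most the half-width, so it gains at most the
     half-width times |q| over the midpoint. *)
  set q := response y s; rewrite -lerBlDl -mulrBl.
  apply: le_trans (ler_norm _) _; rewrite normrM ler_wpM2r// ler_norml.
  by apply/andP; split; lra.
Qed.

Lemma support_reach (alpha beta : R -> R) x0 y : 0 <= t ->
  bounded_measurable `[0, t] alpha -> bounded_measurable `[0, t] beta ->
  (forall s, 0 <= s <= t -> alpha s <= beta s) ->
  support_fun (integrator_reach_set t alpha beta x0) y =
  support_value alpha beta x0 y.
Proof.
by move=> t0 ba bb leab; have [] := support_valueP x0 y t0 ba bb leab; exact: sup_max.
Qed.

Lemma dot_le_support_reach (alpha beta : R -> R) x0 y x : 0 <= t ->
  bounded_measurable `[0, t] alpha -> bounded_measurable `[0, t] beta ->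
  (forall s, 0 <= s <= t -> alpha s <= beta s) ->
  integrator_reach_set t alpha beta x0 x ->
  dot y x <= support_fun (integrator_reach_set t alpha beta x0) y.
Proof.
move=> t0 ba bb leab Xx; rewrite support_reach//.
by have [_] := support_valueP x0 y t0 ba bb leab; apply; exists x.
Qed.

End Support.

(** * The separation as a linear form plus the support function of a zonoid *)

Section Gap.
Context {R : realType} {n : nat}.
Notation mu := (@lebesgue_measure R).
Context (t : R) (alpha beta : agent -> R -> R) (x0 : agent -> 'cV[R]_n).
Hypothesis t_ge0 : 0 <= t.
Hypothesis alpha_cont : forall i, {within `[0, t], continuous (alpha i)}.
Hypothesis beta_cont : forall i, {within `[0, t], continuous (beta i)}.
Hypothesis alpha_le_beta : forall i s, 0 <= s <= t -> alpha i s <= beta i s.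
Implicit Types (y z : 'cV[R]_n) (s : R).

Let halfw := halfwidth alpha beta.
Let mid := midpoint alpha beta.
Let c := Defs.center t alpha beta x0.

Definition width s : R := halfwidth alpha beta AgentA s + halfwidth alpha beta AgentB s.

Let bma i : bounded_measurable `[0, t] (alpha i).
Proof. exact: bounded_measurable_continuous. Qed.

Let bmb i : bounded_measurable `[0, t] (beta i).
Proof. exact: bounded_measurable_continuous. Qed.

Lemma bounded_measurable_halfwidth i :
  bounded_measurable `[0, t] (halfwidth alpha beta i).
Proof. exact/bounded_measurableM/bounded_measurable_cst/bounded_measurableB. Qed.

Lemma bounded_measurable_midpoint i :
  bounded_measurable `[0, t] (midpoint alpha beta i).
Proof. exact/bounded_measurableM/bounded_measurable_cst/bounded_measurableD. Qed.

Lemma halfwidth_ge0 i s : 0 <= s <= t -> 0 <= halfwidth alpha beta i s.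
Proof. by move=> st; rewrite divr_ge0// subr_ge0 alpha_le_beta. Qed.

Lemma bounded_measurable_width : bounded_measurable `[0, t] width.
Proof. by apply: bounded_measurableD; exact: bounded_measurable_halfwidth. Qed.

Lemma width_ge0 s : 0 <= s <= t -> 0 <= width s.
Proof. by move=> st; rewrite addr_ge0// halfwidth_ge0. Qed.

(** Support function of the zonoid obtained by integrating the segments [-gamma(s), gamma(s)], that
    is, of X^A - X^B recentred at the origin. *)
Definition zonoid y : R := \int[mu]_(s in `[0, t]) (width s * `|response t y s|).

Lemma bounded_measurable_zonoid y :
  bounded_measurable `[0, t] (fun s => width s * `|response t y s|).
Proof.
apply: bounded_measurableM bounded_measurable_width _.
exact/bounded_measurable_norm/bounded_measurable_response.
Qed.

Lemma centerE y : dot c y = dot (expA t *m x0 AgentA) y - dot (expA t *m x0 AgentB) y +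
  \int[mu]_(s in `[0, t]) ((mid AgentA s - mid AgentB s) * response t y s).
Proof.
rewrite /c /Defs.center expmx_intA dotDl mulmxBr -dot_integral_xi; last first.
  exact/bounded_measurableB/bounded_measurable_midpoint/bounded_measurable_midpoint.
by rewrite dotDl -scaleN1r dotZl mulN1r.
Qed.

(** For agent B, replacing y by -y flips the linear terms and leaves the absolute values alone;
    hence the midpoints subtract while the half-widths add. *)
Lemma separationE y : separation t alpha beta x0 y = dot c y + zonoid y.
Proof.
rewrite /separation /= !support_reach//; [|exact: alpha_le_beta..].
rewrite /support_value.
rewrite centerE dotNr addrACA -[RHS]addrA; congr (_ + _).
have bmr := bounded_measurable_response t 0 t y.
have bmid i := bounded_measurable_midpoint i.
have bh i := bounded_measurable_halfwidth i.
have bI f g : bounded_measurable `[0, t] f -> bounded_measurable `[0, t] g ->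
    bounded_measurable `[0, t] (fun s => f s * response t y s + g s * `|response t y s|).
  move=> bf bg; apply: bounded_measurableD; apply: bounded_measurableM => //.
  exact: bounded_measurable_norm.
transitivity (\int[mu]_(s in `[0, t])
    ((mid AgentA s * response t y s + halfw AgentA s * `|response t y s|) +
     (- mid AgentB s * response t y s + halfw AgentB s * `|response t y s|))).
  rewrite [RHS]RintegralD//; last 2 first.
  - by apply: bounded_measurable_integrable; exact: bI (bmid _) (bh _).
  - apply: bounded_measurable_integrable; apply: (bI (fun s => - mid AgentB s)) => //.
    by apply: eq_bounded_measurable (bounded_measurableZ (-1) (bmid AgentB)) => s _;
      rewrite mulN1r.
  congr (_ + _); apply: eq_Rintegral => s _.
  by rewrite responseN normrN mulrN mulNr.
rewrite -RintegralD//; last 2 first.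
- exact/bounded_measurable_integrable/bounded_measurableM/bmr/bounded_measurableB.
- exact/bounded_measurable_integrable/bounded_measurable_zonoid.
by apply: eq_Rintegral => s _; rewrite /width /halfw; ring.
Qed.

Lemma zonoidZ a y : 0 <= a -> zonoid (a *: y) = a * zonoid y.
Proof.
move=> a0; rewrite /zonoid -RintegralZl//; last first.
  exact/bounded_measurable_integrable/bounded_measurable_zonoid.
by apply: eq_Rintegral => s _; rewrite responseZ normrM ger0_norm// mulrCA.
Qed.

Lemma separationZ : pos_homogeneous (separation t alpha beta x0).
Proof. by move=> a y a0; rewrite !separationE dotZr zonoidZ// mulrDr. Qed.

(** The reverse triangle inequality under the integral gives a Lipschitz bound in each coordinate,
    with the integral of [width] times |xi_i| as constant. *)
Lemma continuous_zonoid : continuous zonoid.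
Proof.
pose C i := \int[mu]_(s in `[0, t]) (width s * `|xi n (t - s) i 0|).
have bC i : bounded_measurable `[0, t] (fun s => width s * `|xi n (t - s) i 0|).
  apply: bounded_measurableM bounded_measurable_width _.
  exact/bounded_measurable_norm/bounded_measurable_cont/continuous_xi.
apply: (@continuous_lipschitz _ _ C) => y z.
rewrite /zonoid -RintegralB//; last 2 first.
- exact/bounded_measurable_integrable/bounded_measurable_zonoid.
- exact/bounded_measurable_integrable/bounded_measurable_zonoid.
have bd : bounded_measurable `[0, t]
    (fun s => width s * `|response t y s| - width s * `|response t z s|).
  exact/bounded_measurableB/bounded_measurable_zonoid/bounded_measurable_zonoid.
apply: le_trans (le_normr_Rintegral _ _) _ => //.
  exact: bounded_measurable_integrable.
have bS i : bounded_measurable `[0, t]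
    (fun s => width s * `|xi n (t - s) i 0| * `|y i 0 - z i 0|).
  exact/(bounded_measurableM (bC i))/bounded_measurable_cst.
have -> : \sum_i C i * `|y i 0 - z i 0| = \int[mu]_(s in `[0, t])
    \sum_i width s * `|xi n (t - s) i 0| * `|y i 0 - z i 0|.
  rewrite Rintegral_sum//; apply: eq_bigr => i _; rewrite RintegralZr//.
  exact: bounded_measurable_integrable.
apply: le_Rintegral => //.
- exact/bounded_measurable_integrable/bounded_measurable_norm.
- exact/bounded_measurable_integrable/bounded_measurable_sum.
move=> s /=; rewrite in_itv/= => st; rewrite -mulrBr normrM ger0_norm ?width_ge0//.
under eq_bigr do rewrite -mulrA -normrM.
rewrite -mulr_sumr ler_wpM2l ?width_ge0//.
apply: le_trans (ler_dist_dist _ _) _.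
rewrite -responseN -responseD; apply: le_trans (ler_norm_sum _ _ _) _.
by apply: ler_sum => i _; rewrite !mxE.
Qed.

Lemma continuous_separation : continuous (separation t alpha beta x0).
Proof.
have -> : separation t alpha beta x0 = fun y => dot c y + zonoid y.
  by apply/funext => y; exact: separationE.
by move=> y; apply: continuousD; [exact: continuous_dot|exact: continuous_zonoid].
Qed.

End Gap.

(** * Zeros of the response and difference quotients of the absolute value *)

Lemma finite_set_roots {R : idomainType} (p : {poly R}) :
  p != 0 -> finite_set [set x | root p x].
Proof.
move=> p0; apply: contrapT => /(infinite_set_fset (size p))[B Bp].
apply/negP; rewrite -ltnNge; apply: max_poly_roots => //.
  by apply/allP => x xB; exact: Bp.
exact: finmap.fset_uniq.
Qed.

Section Response.
Context {R : realType} {n : nat}.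
Notation mu := (@lebesgue_measure R).
Implicit Types (y : 'cV[R]_n) (t : R).

(** As a function of t - s the response is a polynomial. The entries of y, up to nonzero factors,
    are its coefficients in pairwise distinct degrees, so it is not the zero polynomial. *)
Lemma finite_response_zeros t y : y != 0 -> finite_set [set s | response t y s = 0].
Proof.
move=> y0.
pose p : {poly R} := \sum_(i < n) (y i 0 / (n - i.+1)`!%:R) *: 'X^(n - i.+1).
have pE s : p.[t - s] = response t y s.
  rewrite horner_sum; apply: eq_bigr => i _.
  by rewrite hornerZ hornerXn mxE; ring.
have p0 : p != 0.
  have [i yi0] : exists i, y i 0 != 0.
    apply/existsP; apply: contraNT y0 => /existsPn yi.
    by apply/eqP/colP => i; rewrite mxE; apply/eqP; have := yi i; rewrite negbK.
  apply: contra_neq yi0 => p0; have := coef0 R (n - i.+1); rewrite -p0 coef_sum.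
  rewrite (bigD1 i)//= coefZ coefXn eqxx mulr1 big1 ?addr0; last first.
    move=> k ki; rewrite coefZ coefXn; case: eqP => [ik|]; last by rewrite mulr0.
    case/eqP: ki; apply/val_inj => /=.
    by have := ltn_ord i; have := ltn_ord k; lia.
  by move/eqP; rewrite mulf_eq0 invr_eq0 pnatr_eq0 eqn0Ngt fact_gt0 orbF => /eqP.
have := finite_image (fun x => t - x) (finite_set_roots p0).
apply: sub_finite_set => s /= ys; exists (t - s); last by rewrite subKr.
by apply/rootP; rewrite pE.
Qed.

Lemma ae_response_neq0 t y : y != 0 -> {ae mu, forall s, response t y s != 0}.
Proof.
move=> y0; exists [set s | response t y s = 0]; split.
- exact/countable_measurable/finite_set_countable/finite_response_zeros.
- exact/countable_lebesgue_measure0/finite_set_countable/finite_response_zeros.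
- by move=> s /= /negP; rewrite negbK => /eqP.
Qed.

(** The perturbation b / m is too small to change the sign of a, so the quotient equals the
    derivative exactly and not merely in the limit. *)
Lemma norm_quotient (a b m : R) : 0 < m -> a != 0 -> `|b| <= m * `|a| ->
  m * (`|a + m^-1 * b| - `|a|) = Num.sg a * b.
Proof.
move=> m0 a0 ba; have mE : m * (m^-1 * b) = b by rewrite mulrA divff ?mul1r ?gt_eqF.
have [an|ap|/eqP] := ltgtP a 0; last by rewrite (negPf a0).
- rewrite (ltr0_norm an) in ba *; rewrite ltr0_sg// ler0_norm; first by lra.
  by move: ba; rewrite -(pmulr_rle0 _ m0) mulrDr mE ler_norml => /andP[_ ?]; lra.
- rewrite (gtr0_norm ap) in ba *; rewrite gtr0_sg// ger0_norm; first by lra.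
  by move: ba; rewrite -(pmulr_rge0 _ m0) mulrDr mE ler_norml => /andP[? _]; lra.
Qed.

(** A bound independent of m, which supplies the dominating function for the quotients of
    [zonoid]. *)
Lemma norm_quotient_le (a b m : R) : 0 < m ->
  `|m * (`|a + m^-1 * b| - `|a|)| <= `|b|.
Proof.
move=> m0; rewrite normrM gtr0_norm// -ler_pdivlMl// -[X in X * `|b|]gtr0_norm ?invr_gt0//.
by rewrite -normrM (le_trans (ler_dist_dist _ _))// addrAC subrr add0r.
Qed.

End Response.

(** * First-order condition at a minimiser *)

Section Stationary.
Context {R : realType} {n : nat}.
Notation mu := (@lebesgue_measure R).
Context (t : R) (alpha beta : agent -> R -> R).
Hypothesis alpha_cont : forall i, {within `[0, t], continuous (alpha i)}.
Hypothesis beta_cont : forall i, {within `[0, t], continuous (beta i)}.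
Implicit Types (y z v c : 'cV[R]_n) (s : R).
Let w := width alpha beta.

Lemma bounded_measurable_sg_response y v : bounded_measurable `[0, t]
  (fun s => w s * (Num.sg (response t y s) * response t v s)).
Proof.
apply: bounded_measurableM; first exact: bounded_measurable_width.
apply: bounded_measurableM; last exact: bounded_measurable_response.
by apply: bounded_measurable_sg; case: (bounded_measurable_response t 0 t y).
Qed.

(* Difference quotients of the zonoid support function converge by dominated
   convergence, since the response to [y] vanishes at finitely many times only. *)
Lemma cvg_zonoid_quotient y v : y != 0 ->
  k.+1%:R * (zonoid t alpha beta (y + k.+1%:R^-1 *: v) - zonoid t alpha beta y)
    @[k --> \oo] -->
  \int[mu]_(s in `[0, t]) (w s * (Num.sg (response t y s) * response t v s)).
Proof.
move=> y0.
pose h k s : R := w s * (k.+1%:R *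
  (`|response t y s + k.+1%:R^-1 * response t v s| - `|response t y s|)).
have br z := bounded_measurable_response t 0 t z.
have bw := bounded_measurable_width alpha_cont beta_cont.
have bh k : bounded_measurable `[0, t] (h k).
  apply/(bounded_measurableM bw)/bounded_measurableZ/bounded_measurableB.
    exact/bounded_measurable_norm/bounded_measurableD/bounded_measurableZ.
  exact: bounded_measurable_norm.
have -> : (fun k => k.+1%:R *
    (zonoid t alpha beta (y + k.+1%:R^-1 *: v) - zonoid t alpha beta y)) =
    fun k => \int[mu]_(s in `[0, t]) h k s.
  apply/funext => k; rewrite /zonoid -RintegralB//; last 2 first.
  - exact/bounded_measurable_integrable/bounded_measurable_zonoid.
  - exact/bounded_measurable_integrable/bounded_measurable_zonoid.
  rewrite -RintegralZl//; last first.
    apply/bounded_measurable_integrable/bounded_measurableB;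
      exact: bounded_measurable_zonoid.
  by apply: eq_Rintegral => s _; rewrite /h -mulrBr responseD responseZ mulrCA.
have bg : bounded_measurable `[0, t] (fun s => `|w s * response t v s|).
  exact/bounded_measurable_norm/bounded_measurableM.
have bl := bounded_measurable_sg_response y v.
have [||||||_ _] := @dominated_convergence _ _ _ mu `[0, t]%classic _
    (fun k s => (h k s)%:E)
    (fun s => (w s * (Num.sg (response t y s) * response t v s))%:E)
    (fun s => `|w s * response t v s|%:E).
- by [].
- by move=> k; apply/measurable_EFinP; case: (bh k).
- by apply/measurable_EFinP; case: bl.
- have [Z [mZ Z0 neq0Z]] := ae_response_neq0 t y0.
  exists Z; split=> // s /= nlim; apply: neq0Z => /= ys; apply: nlim => _.
  apply: cvg_near_cst.
  (* From this index on [norm_quotient] applies, so the integrand at s no longer depends on k. *)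
  pose N := (Num.truncn (`|response t v s| / `|response t y s|)).
  exists N => // k /= Nk; congr EFin; congr (_ * _); apply: norm_quotient => //.
  rewrite -ler_pdivrMr ?normr_gt0//.
  apply: le_trans (ltW (truncnS_gt _)) _.
  by rewrite ler_nat.
- exact: bounded_measurable_integrable.
- apply: aeW => s k _; rewrite lee_fin /h !normrM ler_wpM2l//.
  by rewrite -normrM; exact: norm_quotient_le.
move=> cvgh; apply: fine_cvg.
by rewrite /Rintegral fineK//; apply: integrable_fin_num => //;
  exact: bounded_measurable_integrable.
Qed.

(** The combination is nonnegative everywhere and zero at y, so its difference quotients at y along
    v are nonnegative; the bound passes to the limit. *)
Lemma stationary_ge0 (a b : R) c y v : y != 0 ->
  (forall z, 0 <= a * zonoid t alpha beta z + b * dot c z) ->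
  a * zonoid t alpha beta y + b * dot c y = 0 ->
  0 <= a * (\int[mu]_(s in `[0, t])
              (w s * (Num.sg (response t y s) * response t v s))) + b * dot c v.
Proof.
move=> y0 G0 Gy.
have cvgq : a * (k.+1%:R * (zonoid t alpha beta (y + k.+1%:R^-1 *: v) -
      zonoid t alpha beta y)) + b * dot c v @[k --> \oo] -->
    a * (\int[mu]_(s in `[0, t])
           (w s * (Num.sg (response t y s) * response t v s))) + b * dot c v.
  by apply: cvgD; [apply: cvgMl_tmp; exact: cvg_zonoid_quotient|exact: cvg_cst].
rewrite -(cvg_lim _ cvgq)//; apply: limr_ge; first exact: cvgP cvgq.
apply: nearW => k; set m : R := k.+1%:R; have m0 : 0 < m by rewrite ltr0n.
have -> : a * (m * (zonoid t alpha beta (y + m^-1 *: v) - zonoid t alpha beta y)) +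
    b * dot c v =
    m * (a * zonoid t alpha beta (y + m^-1 *: v) + b * dot c (y + m^-1 *: v)) -
    m * (a * zonoid t alpha beta y + b * dot c y).
  by rewrite dotDr dotZr; field; rewrite gt_eqF.
by rewrite Gy mulr0 subr0 mulr_ge0// ltW.
Qed.

(** The directional derivative [L] is linear in v and nonnegative at both v and -v, hence zero;
    testing it on the basis vectors gives the vector identity. *)
Lemma stationary (a b : R) c y : y != 0 ->
  (forall z, 0 <= a * zonoid t alpha beta z + b * dot c z) ->
  a * zonoid t alpha beta y + b * dot c y = 0 ->
  b *: c = - a *: integral_cV `[0, t]
    (fun s => (w s * Num.sg (response t y s)) *: xi n (t - s)).
Proof.
move=> y0 G0 Gy.
have bws : bounded_measurable `[0, t] (fun s => w s * Num.sg (response t y s)).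
  apply: bounded_measurableM; first exact: bounded_measurable_width.
  by apply: bounded_measurable_sg; case: (bounded_measurable_response t 0 t y).
pose L v := a * (\int[mu]_(s in `[0, t])
  (w s * (Num.sg (response t y s) * response t v s))) + b * dot c v.
have LE v : L v = dot (b *: c + a *: integral_cV `[0, t]
    (fun s => (w s * Num.sg (response t y s)) *: xi n (t - s))) v.
  rewrite /L dotDl !dotZl dot_integral_xi// addrC; congr (_ + _ * _).
  by apply: eq_Rintegral => s _; rewrite mulrA.
have L0 v : L v = 0.
  apply/le_anti; rewrite [X in _ && X]stationary_ge0// andbT -oppr_ge0.
  by rewrite LE -dotNr -LE stationary_ge0.
apply/eqP; rewrite scaleNr -addr_eq0; apply/eqP/colP => i.
by rewrite -dot_delta -LE L0 mxE.
Qed.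

End Stationary.

(** * Nonnegative separation and intersection of the reach sets *)

Section Intersection.
Context {R : realType} {n : nat}.
Notation mu := (@lebesgue_measure R).
Context (t : R) (alpha beta : agent -> R -> R) (x0 : agent -> 'cV[R]_n).
Hypothesis t_ge0 : 0 <= t.
Hypothesis alpha_cont : forall i, {within `[0, t], continuous (alpha i)}.
Hypothesis beta_cont : forall i, {within `[0, t], continuous (beta i)}.
Hypothesis alpha_le_beta : forall i s, 0 <= s <= t -> alpha i s <= beta i s.
Implicit Types (y z : 'cV[R]_n) (s : R).

Let halfw := halfwidth alpha beta.
Let mid := midpoint alpha beta.
Let c := Defs.center t alpha beta x0.
Let sep := separation t alpha beta x0.
Let X i := integrator_reach_set t (alpha i) (beta i) (x0 i).

Let bma i : bounded_measurable `[0, t] (alpha i).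
Proof. exact: bounded_measurable_continuous. Qed.

Let bmb i : bounded_measurable `[0, t] (beta i).
Proof. exact: bounded_measurable_continuous. Qed.

(** At a common point z the bounds of <y, z> and <-y, z> by the two support functions add up to 0 <=
    [sep y]. *)
Lemma intersect_separation_ge0 z y : X AgentA z -> X AgentB z -> 0 <= sep y.
Proof.
move=> XAz XBz.
have hA := dot_le_support_reach y t_ge0 (bma _) (bmb _) (alpha_le_beta AgentA) XAz.
have hB := dot_le_support_reach (- y) t_ge0 (bma _) (bmb _) (alpha_le_beta AgentB) XBz.
by have := lerD hA hB; rewrite [dot (- y) z]dotC dotNr dotC subrr.
Qed.

(* Either the separation vanishes at some unit vector, or [dot c y / sep y] has a
   minimum on the sphere; in both cases a nonnegative combination of the zonoid
   support function and [dot c] is minimal at a nonzero vector. *)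
Lemma center_zonoid : (0 < n)%N -> (forall y, unit_sphere y -> 0 <= sep y) ->
  exists2 k : R, 0 <= k <= 1 & exists y, c = - k *: integral_cV `[0, t]
    (fun s => (width alpha beta s * Num.sg (response t y s)) *: xi n (t - s)).
Proof.
move=> n0 sep0.
have unit_neq0 y : unit_sphere y -> y != 0.
  by move=> y1; apply/eqP => y0; move: y1; rewrite y0 /unit_sphere/= norm2_0 => /eqP;
    rewrite eq_sym oner_eq0.
have csep : continuous sep by exact: continuous_separation.
have sepE y : sep y = dot c y + zonoid t alpha beta y by exact: separationE.
have [y1 Sy1 min1] := compact_min csep compact_unit_sphere (unit_sphere_neq0 n0).
have [sy1|sy1] := eqVneq (sep y1) 0.
  exists 1; first by rewrite ler01 lexx.
  exists y1; rewrite -[LHS]scale1r.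
  apply: (stationary alpha_cont beta_cont (unit_neq0 _ Sy1)) => [z|].
    rewrite !mul1r addrC -sepE; apply: pos_homogeneous_ge0 z => //.
    exact: separationZ.
  by rewrite !mul1r addrC -sepE.
have sep_gt0 y : unit_sphere y -> 0 < sep y.
  by move=> Sy; rewrite (lt_le_trans _ (min1 _ Sy))// lt_def sy1 sep0.
pose q y := dot c y / sep y.
have cq : {within unit_sphere, continuous q}.
  apply: continuous_in_subspaceT => y; rewrite inE => /sep_gt0 /gt_eqF/negbT sy.
  by apply: continuousM; [exact: continuous_dot|apply: continuousV => //; exact: csep].
have [y0] := compact_EVT_min (unit_sphere_neq0 n0) compact_unit_sphere cq.
rewrite inE => Sy0 minq.
(* One of [y1] and [- y1] pairs nonpositively with [c], and [sep] is positive at both, so [q] takes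
   a nonpositive value on the sphere. *)
have q0 : q y0 <= 0.
  have [cy|cy] := leP (dot c y1) 0.
    rewrite (le_trans (minq y1 _)) ?inE//.
    by rewrite pmulr_lle0// invr_gt0 sep_gt0.
  have SNy1 : unit_sphere (- y1) by rewrite /unit_sphere/= norm2N.
  rewrite (le_trans (minq (- y1) _)) ?inE//.
  by rewrite pmulr_lle0 ?invr_gt0 ?sep_gt0// dotNr oppr_le0 ltW.
have b0 : 0 < 1 - q y0 by rewrite subr_gt0 (le_lt_trans q0).
exists (- q y0 / (1 - q y0)).
  by rewrite divr_ge0 ?oppr_ge0 ?(ltW b0)//= ler_pdivrMr// mul1r lerDr ler01.
exists y0.
(* In this form the combination is visibly nonnegative on the sphere, because [q y0] is the minimum
   of [q], and zero at [y0]. *)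
have combE z : - q y0 * zonoid t alpha beta z + (1 - q y0) * dot c z =
    dot c z - q y0 * sep z.
  by rewrite sepE; ring.
rewrite -[LHS](scalerK (negbT (gt_eqF b0))).
rewrite (stationary alpha_cont beta_cont (a := - q y0) (b := 1 - q y0)
  (unit_neq0 _ Sy0)).
- by rewrite scalerA mulrN mulrC.
- apply: pos_homogeneous_ge0 => [a y a0|y Sy].
    by rewrite zonoidZ// dotZr; ring.
  rewrite combE subr_ge0 -ler_pdivlMr ?sep_gt0//.
  by apply: minq; rewrite inE.
- by rewrite combE /q divfK ?subrr// gt_eqF// sep_gt0.
Qed.

Lemma separation_ge0_intersect : (0 < n)%N ->
  (forall y, unit_sphere y -> 0 <= sep y) -> X AgentA `&` X AgentB !=set0.
Proof.
move=> n0 /(center_zonoid n0)[k /andP[k0 k1] [y cE]].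
pose sg s := Num.sg (response t y s).
have bsg : bounded_measurable `[0, t] sg.
  by apply: bounded_measurable_sg; case: (bounded_measurable_response t 0 t y).
have bh i : bounded_measurable `[0, t] (fun s => halfw i s * sg s).
  by apply: bounded_measurableM => //; exact: bounded_measurable_halfwidth.
have bm i : bounded_measurable `[0, t] (mid i) by exact: bounded_measurable_midpoint.
(* For a in [-1, 1] this input respects the bounds of agent i; agent A takes a = k and agent B takes
   a = -k. *)
pose u i (a : R) s := mid i s + a * (halfw i s * sg s).
have Xu i (a : R) : -1 <= a <= 1 -> X i (flow (x0 i) (u i a) t).
  move=> /andP[aN1 a1]; rewrite /X reach_setE//; exists (u i a) => //.
  split; first by have [] := bounded_measurableD (bm i) (bounded_measurableZ a (bh i)).
  move=> s st; have := halfwidth_ge0 alpha_le_beta i st.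
  have -> : alpha i s = mid i s - halfw i s.
    by rewrite /mid /halfw /midpoint /halfwidth; field.
  have -> : beta i s = mid i s + halfw i s.
    by rewrite /mid /halfw /midpoint /halfwidth; field.
  rewrite -/halfw /u /sg => h0; rewrite lerD2l lerD2l.
  by case: sgrP => _; rewrite ?mulr1 ?mulr0 ?mulrN1; apply/andP; split; nra.
exists (flow (x0 AgentA) (u AgentA k) t); split.
  by apply: Xu; rewrite k1 (le_trans _ k0)// lerN10.
(* The two end points differ by [c] plus k times the integral in [cE], which is zero. *)
have -> : flow (x0 AgentA) (u AgentA k) t = flow (x0 AgentB) (u AgentB (- k)) t.
  rewrite !flow_xi !integral_xiD ?integral_xiZ//; try exact: bounded_measurableZ.
  move: cE; rewrite /c /Defs.center expmx_intA mulmxBr.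
  rewrite (_ : (fun s => (midpoint alpha beta AgentA s - midpoint alpha beta AgentB s)
    *: xi n (t - s)) = fun s => (mid AgentA s + -1 * mid AgentB s) *: xi n (t - s)).
    rewrite integral_xiD ?integral_xiZ//; try exact: bounded_measurableZ.
    rewrite (_ : (fun s => (width alpha beta s * Num.sg (response t y s)) *: xi n (t - s))
      = fun s => (halfw AgentA s * sg s + halfw AgentB s * sg s) *: xi n (t - s)).
      rewrite integral_xiD//.
      set EA := expA t *m x0 AgentA; set EB := expA t *m x0 AgentB.
      set hA := integral_cV _ _; set hB := integral_cV _ _.
      set mA := integral_cV _ _; set mB := integral_cV _ _.
      move=> /colP E; apply/colP => i; move: (E i); rewrite !mxE; lra.
    by apply/funext => s; rewrite -mulrDl.
  by apply/funext => s; rewrite mulN1r.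
by apply: Xu; rewrite lerN2 k1/= (le_trans _ ler01)// oppr_le0.
Qed.

End Intersection.

(** * Uniform continuity on a segment *)

Section UniformContinuity.
Context {R : realType}.

(** Compactness, in its near-covering form, reduces the claim to one point x. There x' within r / 2
    of x and d < r / 2 keep both x' and y within r of x, where f varies from f x by less than e /
    2. *)
Lemma uniform_continuity_segment (a b : R) (f : R -> R) (e : R) : 0 < e ->
  {within `[a, b], continuous f} ->
  \forall d \near (0 : R)^'+, forall x y, a <= x <= b -> a <= y <= b ->
    `|x - y| <= d -> `|f x - f y| <= e.
Proof.
move=> e0 cf.
have /compact_near_coveringP cov := @segment_compact R a b.
pose P (d x : R) := forall y, a <= x <= b -> a <= y <= b ->
  `|x - y| <= d -> `|f x - f y| <= e.
suff loc x : `[a, b]%classic x -> \forall x' \near x & d \near (0 : R)^'+, P d x'.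
  apply: filterS (cov _ _ P _ loc) => d Hd x y xab.
  by apply: Hd => //; rewrite /= in_itv.
move=> xab.
have /subspace_continuousP/(_ x xab)/cvgrPdist_lt/(_ (e / 2)) := cf.
rewrite divr_gt0// => /(_ isT)/nbhs_ballP[r /= r0 Hr].
have r20 : 0 < r / 2 by rewrite divr_gt0.
near=> x' d => y /= x'ab yab x'y.
have x'x : `|x - x'| < r / 2 by near: x'; apply/nbhs_ballP; exists (r / 2).
have dr : d < r / 2 by near: d; exact: nbhs_right_lt.
have hx' : `|f x - f x'| < e / 2.
  by apply: Hr; rewrite ?in_itv//= -ball_normE/= (lt_trans x'x)//; lra.
have hy : `|f x - f y| < e / 2.
  apply: Hr; rewrite ?in_itv//= -ball_normE/=.
  have -> : x - y = (x - x') + (x' - y) by ring.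
  by rewrite (le_lt_trans (ler_normD _ _))//; lra.
have -> : f x' - f y = (f x - f y) - (f x - f x') by ring.
by rewrite (le_trans (ler_normB _ _))//; lra.
Unshelve. all: by end_near. Qed.

End UniformContinuity.

(** * Error of the trapezoidal rule *)

Section Trapezoid.
Context {R : realType}.
Notation mu := (@lebesgue_measure R).
Implicit Types (f : R -> R) (F : nat -> R) (d e t : R).

(** The mean of the two end values is within e of every value on the cell; integrating this bound
    gives the factor b - a. *)
Lemma trapezoid_cell (a b e : R) f : a <= b -> bounded_measurable `[a, b] f ->
  (forall x y, a <= x <= b -> a <= y <= b -> `|f x - f y| <= e) ->
  `|(b - a) * ((f a + f b) / 2) - \int[mu]_(s in `[a, b]) f s| <= (b - a) * e.
Proof.
move=> ab bf fe; rewrite mulrC -Rintegral_itv_cst//.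
rewrite -RintegralB//; last 2 first.
- exact/bounded_measurable_integrable/bounded_measurable_cst.
- exact: bounded_measurable_integrable.
have bd : bounded_measurable `[a, b] (fun s => (f a + f b) / 2 - f s).
  exact: bounded_measurableB (bounded_measurable_cst _ _) bf.
apply: le_trans (le_normr_Rintegral _ _) _ => //.
  exact: bounded_measurable_integrable.
rewrite [leRHS]mulrC -Rintegral_itv_cst//; apply: le_Rintegral => //.
- exact/bounded_measurable_integrable/bounded_measurable_norm.
- exact/bounded_measurable_integrable/bounded_measurable_cst.
move=> s /=; rewrite in_itv/= => sab.
have := fe a s; have := fe b s; rewrite !lexx ab/= sab => /(_ isT isT) + /(_ isT isT).
by rewrite !ler_norml => /andP[? ?] /andP[? ?]; apply/andP; split; lra.
Qed.

(** The cell errors d e are summed by induction over the initial segments [0, kd]. *)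
Lemma trapezoid_error (d e : R) (K : nat) f : 0 <= d ->
  bounded_measurable `[0, K%:R * d] f ->
  (forall x y, 0 <= x <= K%:R * d -> 0 <= y <= K%:R * d -> `|x - y| <= d ->
     `|f x - f y| <= e) ->
  `|\sum_(k < K) d * ((f (k%:R * d) + f (k.+1%:R * d)) / 2) -
    \int[mu]_(s in `[0, K%:R * d]) f s| <= K%:R * d * e.
Proof.
move=> d0 bf fe.
suff H k : (k <= K)%N ->
    `|\sum_(i < k) d * ((f (i%:R * d) + f (i.+1%:R * d)) / 2) -
      \int[mu]_(s in `[0, k%:R * d]) f s| <= k%:R * d * e by exact: H.
elim: k => [_|k IH kK].
  by rewrite big_ord0 !mul0r set_itv1 Rintegral_set1 subrr normr0.
have kd0 : 0 <= k%:R * d by rewrite mulr_ge0.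
have kdS : k%:R * d <= k.+1%:R * d by rewrite ler_wpM2r// ler_nat.
have kdK : k.+1%:R * d <= K%:R * d by rewrite ler_wpM2r// ler_nat.
have Sd : k.+1%:R * d - k%:R * d = d by rewrite -mulrBl -natrB// subSnn mul1r.
have bS : bounded_measurable `[0, k.+1%:R * d] f by exact: bounded_measurable_sub bf.
have bk : bounded_measurable `[k%:R * d, k.+1%:R * d] f.
  exact: bounded_measurable_sub bS.
have split_int : \int[mu]_(s in `[0, k.+1%:R * d]) f s =
    \int[mu]_(s in `[0, k%:R * d]) f s +
    \int[mu]_(s in `[k%:R * d, k.+1%:R * d]) f s.
  (* The cell is opened on the left, at the cost of a null set, so that it is the difference of two
     initial segments. *)
  rewrite -(@Rintegral_itv_obnd_cbnd _ (k%:R * d)); last first.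
    apply: integrableS (bounded_measurable_integrable bk) => //.
    by move=> x /=; rewrite !in_itv/= => /andP[/ltW -> ->].
  rewrite -(@Rintegral_itvB _ f (BLeft 0) (BRight (k.+1%:R * d)) (k%:R * d)) ?bnd_simp//.
    by rewrite addrC subrK.
  exact: bounded_measurable_integrable.
rewrite big_ord_recr/= split_int opprD addrACA.
apply: le_trans (ler_normD _ _) _.
have -> : k.+1%:R * d * e = k%:R * d * e + d * e.
  by rewrite -mulrDl -[X in _ + X]mul1r -mulrDl natr1.
apply: lerD; first exact/IH/ltnW.
rewrite -[X in X * (_ / 2)]Sd -[X in _ <= X * _]Sd.
apply: trapezoid_cell => // x y /andP[kx xk] /andP[ky yk].
apply: fe; [apply/andP; split; lra|apply/andP; split; lra|].
by rewrite ler_norml; apply/andP; split; lra.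
Qed.

(** Inner nodes belong to two cells and end nodes to one. For K = 0 the two ends coincide: the left
    side would keep d F(0) / 2 while the right side is empty. *)
Lemma trapezoid_sum (d : R) (K : nat) F : (0 < K)%N ->
  \sum_(k < K.+1) d * (if (k == ord0) || (k == ord_max) then 2^-1 else 1) * F k =
  \sum_(k < K) d * ((F k + F k.+1) / 2).
Proof.
case: K => // K _; rewrite big_ord_recl big_ord_recr/=.
rewrite (_ : lift ord0 ord_max == ord_max); last by rewrite -val_eqE/= /bump add1n.
have -> : \sum_(k < K.+1) d * ((F k + F k.+1) / 2) =
    d / 2 * (\sum_(k < K.+1) F k + \sum_(k < K.+1) F k.+1).
  by rewrite -big_split mulr_sumr; apply: eq_bigr => k _ /=; field.
rewrite [\sum_(k < K.+1) F k]big_ord_recl [\sum_(k < K.+1) F k.+1]big_ord_recr/=.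
have bumpS : forall k, bump 0 k = k.+1 by [].
rewrite (eq_bigr (fun k : 'I_K => d * F k.+1)) => [|k _]; last first.
  by rewrite -val_eqE/= bumpS eqSS (ltn_eqF (ltn_ord k)) mulr1.
rewrite -mulr_sumr bumpS; under [in RHS]eq_bigr do rewrite bumpS.
by field.
Qed.

End Trapezoid.

(** * Convergence of the second order cone programs *)

Section SecondOrderConeProgram.
Context {R : realType} {n : nat}.
Notation mu := (@lebesgue_measure R).
Context (t : R) (alpha beta : agent -> R -> R) (x0 : agent -> 'cV[R]_n).
Hypothesis t_gt0 : 0 < t.
Hypothesis alpha_cont : forall i, {within `[0, t], continuous (alpha i)}.
Hypothesis beta_cont : forall i, {within `[0, t], continuous (beta i)}.
Hypothesis alpha_le_beta : forall i s, 0 <= s <= t -> alpha i s <= beta i s.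
Implicit Types (y z : 'cV[R]_n) (s e : R) (K : nat).

Let c := Defs.center t alpha beta x0.
Let sep := separation t alpha beta x0.
Let gen : R -> 'cV[R]_n := Defs.generator t alpha beta.

Lemma generatorE s y : dot (gen s) y = width alpha beta s * response t y s.
Proof. exact: dotZl. Qed.

Lemma zonoid_generator y :
  zonoid t alpha beta y = \int[mu]_(s in `[0, t]) `|dot (gen s) y|.
Proof.
apply: eq_Rintegral => s; rewrite inE/= in_itv/= => st.
by rewrite generatorE normrM (ger0_norm (width_ge0 alpha_le_beta st)).
Qed.

Lemma bounded_measurable_generator y :
  bounded_measurable `[0, t] (fun s => `|dot (gen s) y|).
Proof.
apply: eq_bounded_measurable (bounded_measurable_zonoid alpha_cont beta_cont y).
move=> s; rewrite inE/= in_itv/= => st.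
by rewrite generatorE normrM (ger0_norm (width_ge0 alpha_le_beta st)).
Qed.

Lemma continuous_generator i : {within `[0, t], continuous (fun s => gen s i 0)}.
Proof.
have -> : (fun s => gen s i 0) = fun s =>
    ((beta AgentA s - alpha AgentA s) + (beta AgentB s - alpha AgentB s)) *
    (2^-1 * xi n (t - s) i 0).
  by apply/funext => s; rewrite mxE /halfwidth; field.
have cx : continuous (fun s => 2^-1 * (xi n (t - s) i 0 : R)).
  by move=> s; apply: cvgMl_tmp; exact: continuous_xi.
have cw : {within `[0, t], continuous (fun s =>
    (beta AgentA s - alpha AgentA s) + (beta AgentB s - alpha AgentB s))}.
  by apply: within_continuousD; apply: within_continuousB.
move=> s; exact: (@continuousM R (subspace `[0, t]) _ _ s (cw s)
  (continuous_subspaceT cx (x := s))).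
Qed.

(** The entries of a vector in the unit ball are at most 1 in absolute value, so uniform continuity
    of the entries of gamma gives one modulus for all y. *)
Lemma generator_modulus e : 0 < e -> \forall d \near (0 : R)^'+, forall y,
  norm2 y <= 1 -> forall s s', 0 <= s <= t -> 0 <= s' <= t -> `|s - s'| <= d ->
  `| `|dot (gen s) y| - `|dot (gen s') y| | <= e.
Proof.
(* The divisor is n + 1 so that the quotient is positive also for n = 0. *)
move=> e0; have en0 : 0 < e / n.+1%:R by rewrite divr_gt0.
have : \forall d \near (0 : R)^'+, forall i : 'I_n, forall s s',
    0 <= s <= t -> 0 <= s' <= t -> `|s - s'| <= d ->
    `|gen s i 0 - gen s' i 0| <= e / n.+1%:R.
  apply: filter_forall => i.
  exact: uniform_continuity_segment en0 (@continuous_generator i).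
apply: filterS => d Hd y y1 s s' st s't ss'.
apply: le_trans (ler_dist_dist _ _) _; rewrite -sumrB.
apply: le_trans (ler_norm_sum _ _ _) _.
apply: (@le_trans _ _ (\sum_(i < n) e / n.+1%:R)).
  apply: ler_sum => i _; rewrite -mulrBl normrM -[leRHS]mulr1.
  by rewrite ler_pM// ?Hd// (le_trans (le_norm2 _ _)).
rewrite sumr_const card_ord -[leLHS]mulr_natr mulrAC ler_pdivrMr// ler_pM2l//.
by rewrite ler_nat.
Qed.

(** The least theta that is feasible for y, hence the optimal one since the weights are
    nonnegative. *)
Definition grid_values K y : 'cV[R]_K.+1 :=
  \col_k `|dot (gen (k%:R * grid_step t K)) y|.

Lemma trapezoid_generator e : 0 < e -> \forall K \near \oo, forall y,
  norm2 y <= 1 ->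
  `|dot (trapezoid_weights t K) (grid_values K y) - zonoid t alpha beta y| <= e.
Proof.
(* Oscillation e / t per cell over total length t yields error e. *)
move=> e0; have et0 : 0 < e / t by rewrite divr_gt0.
have /nbhs_ballP[r /= r0 Hr] := generator_modulus et0.
near=> K => y y1.
have K0 : (0 < K)%N by near: K; exact: nbhs_infty_gt.
have KR0 : 0 < K%:R :> R by rewrite ltr0n.
have d0 : 0 < grid_step t K by rewrite divr_gt0.
have Kd : K%:R * grid_step t K = t by rewrite mulrC divfK// gt_eqF.
have dr : grid_step t K < r.
  rewrite /grid_step ltr_pdivrMr// mulrC -ltr_pdivrMr//.
  by near: K; exact: nbhs_infty_gtr.
have -> : dot (trapezoid_weights t K) (grid_values K y) =
    \sum_(k < K) grid_step t K * ((`|dot (gen (k%:R * grid_step t K)) y| +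
       `|dot (gen (k.+1%:R * grid_step t K)) y|) / 2).
  rewrite -(trapezoid_sum _ (fun k => `|dot (gen (k%:R * grid_step t K)) y|) K0).
  by apply: eq_bigr => k _; rewrite !mxE.
have := @trapezoid_error R (grid_step t K) (e / t) K (fun s => `|dot (gen s) y|).
rewrite Kd -zonoid_generator (mulrC t) divfK ?gt_eqF//; apply.
- exact: ltW.
- exact: bounded_measurable_generator.
- move=> x x' xt x't xx'; apply: (Hr (grid_step t K)) => //.
  by rewrite -ball_normE/= sub0r normrN gtr0_norm.
Unshelve. all: by end_near. Qed.

Lemma trapezoid_weights_ge0 K k : 0 <= trapezoid_weights t K k 0.
Proof.
rewrite mxE mulr_ge0//; first by rewrite divr_ge0// ltW.
by case: ifP.
Qed.

(** With theta at its least value the program minimises [sep] up to an error e, uniformly over the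
    ball. The ball minimiser of [sep], with its grid values, bounds the program from above; [lb]
    bounds it from below. *)
Lemma socp_value_error e K : 
  (forall y, norm2 y <= 1 ->
    `|dot (trapezoid_weights t K) (grid_values K y) - zonoid t alpha beta y| <= e) ->
  `|p_ball t alpha beta x0 - socp_value t alpha beta x0 K| <= e.
Proof.
move=> He.
have csep : continuous sep by apply: continuous_separation => //; exact: ltW.
have [[y y1 sepy] pl] := inf_compact csep compact_unit_ball unit_ball_neq0.
have sepE z : sep z = dot c z + zonoid t alpha beta z.
  by apply: separationE => //; exact: ltW.
have feas z : norm2 z <= 1 -> socp_feasible t alpha beta (z, grid_values K z).
  move=> z1; split=> // k; rewrite !mxE/=; split=> //; first exact: ler_norm.
  by rewrite -normrN ler_norm.
(* Every feasible [th] dominates the grid values. The bound serves twice: [ge_inf] also requires the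
   set of objective values to be bounded below. *)
have lb : lbound [set socp_objective t alpha beta x0 z |
    z in socp_feasible t alpha beta (K := K)] (p_ball t alpha beta x0 - e).
  move=> _ [[z th] [/= zth z1] <-]; rewrite /socp_objective/=.
  have : dot (trapezoid_weights t K) (grid_values K z) <=
      dot (trapezoid_weights t K) th.
    apply: ler_sum => k _; rewrite ler_wpM2l ?trapezoid_weights_ge0// mxE.
    by have [? ? _] := zth k; rewrite ler_norml lerNl; apply/andP.
  have := He z z1; rewrite ler_norml => /andP[].
  have : p_ball t alpha beta x0 <= sep z by apply: pl; exists z.
  by rewrite sepE -/c; lra.
rewrite ler_norml; apply/andP; split.
  rewrite lerBrDl addrC -lerBrDl opprK.
  have : socp_value t alpha beta x0 K <= socp_objective t alpha beta x0 (y, grid_values K y).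
    apply: ge_inf; first by exists (p_ball t alpha beta x0 - e).
    by exists (y, grid_values K y) => //; exact: feas.
  move/le_trans; apply; rewrite /socp_objective/= -/c.
  have := He y y1; rewrite ler_norml => /andP[_].
  by move: sepy; rewrite sepE -/(p_ball t alpha beta x0); lra.
rewrite lerBlDl addrC -lerBlDl; apply: lb_le_inf lb.
by exists (socp_objective t alpha beta x0 (y, grid_values K y)),
  (y, grid_values K y) => //; exact: feas.
Qed.

Lemma cvg_socp_value :
  socp_value t alpha beta x0 K @[K --> \oo] --> p_ball t alpha beta x0.
Proof.
apply/cvgrPdist_le => e e0; apply: filterS (trapezoid_generator e0) => K.
exact: socp_value_error.
Qed.

End SecondOrderConeProgram.

(** The limit of vanishing truncation error is taken as K tends to infinity. The hypothesis [r_ge1]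
    makes the unit sphere nonempty, so that the minimum [p] exists. *)
Theorem theorem4 (R : realType) (m : nat) (r : 'I_m -> nat)
  (r_ge1 : forall j, (1 <= r j)%N)
  (t : R) (t_gt0 : 0 < t)
  (alpha beta : agent -> 'I_m -> R -> R)
  (alpha_cont : forall i j, {within `[0, t], continuous (alpha i j)})
  (beta_cont : forall i j, {within `[0, t], continuous (beta i j)})
  (alpha_le_beta : forall i j s, 0 <= s <= t -> alpha i j s <= beta i j s)
  (x0 : agent -> forall j : 'I_m, 'cV[R]_(r j))
  (j : 'I_m) :
  let alphaj i := alpha i j in
  let betaj i := beta i j in
  let x0j i := x0 i j in
  let X i := integrator_reach_set t (alphaj i) (betaj i) (x0j i) in
  let gap := separation t alphaj betaj x0j in
  let p := p_sphere t alphaj betaj x0j in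
  let ptilde := p_ball t alphaj betaj x0j in
  [/\ is_minimum [set gap y | y in unit_sphere] p
        /\ is_minimum [set gap y | y in unit_ball] ptilde,
      (socp_value t alphaj betaj x0j K @[K --> \oo] --> ptilde),
      ptilde <= 0,
      (ptilde = 0 -> 0 <= p) /\ (0 <= p <-> X AgentA `&` X AgentB !=set0)
    & (ptilde < 0 -> ptilde = p /\ p < 0)
        /\ (p < 0 <-> X AgentA `&` X AgentB = set0)].
Proof.
move=> alphaj betaj x0j X gap p ptilde.
have t_ge0 := ltW t_gt0.
have ac i : {within `[0, t], continuous (alphaj i)} by exact: alpha_cont.
have bc i : {within `[0, t], continuous (betaj i)} by exact: beta_cont.
have ab i s : 0 <= s <= t -> alphaj i s <= betaj i s by exact: alpha_le_beta.
have cgap : continuous gap by exact: continuous_separation.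
have gapZ : pos_homogeneous gap by exact: separationZ.
have minp : is_minimum [set gap y | y in unit_sphere] p.
  exact: inf_compact cgap compact_unit_sphere (unit_sphere_neq0 (r_ge1 j)).
have minq : is_minimum [set gap y | y in unit_ball] ptilde.
  exact: inf_compact cgap compact_unit_ball unit_ball_neq0.
have qp : ptilde <= p.
  by have [[y y1 <-] _] := minp; apply: minq.2; exists y => //; rewrite /unit_ball/= y1.
have p_ge0 : 0 <= p <-> X AgentA `&` X AgentB !=set0.
  split=> [p0|[z [XAz XBz]]].
    apply: (separation_ge0_intersect t_ge0 ac bc ab (r_ge1 j)) => y y1.
    by apply: le_trans p0 _; apply: minp.2; exists y.
  have [[y _ <-] _] := minp.
  exact: (intersect_separation_ge0 t_ge0 ac bc ab y XAz XBz).
split.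
- by [].
- exact: cvg_socp_value.
(* The origin lies in the ball and has gap 0. *)
- rewrite -(pos_homogeneous0 gapZ); apply: minq.2.
  by exists 0 => //; rewrite /unit_ball/= norm2_0.
- by split=> // <-.
- split=> [q0|].
    have qpE := pos_homogeneous_min_neg gapZ minp minq q0.
    by rewrite -qpE.
  (* Disjointness is the negation of the intersection criterion [p_ge0]. *)
  rewrite ltNge; split=> [/negP np|X0].
    by apply/eqP/negPn/negP => /set0P /p_ge0.
  by apply/negP => /p_ge0 /set0P; rewrite X0 eqxx.
Qed.
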